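(* The characteristic polynomials of the posets $\Pi_W^{(2)}$ for the exceptional types of rank $\geq 3$ are: $$\begin{aligned} \chi(\Pi_{H_3}^{(2)},t)&=1-16t,\\ \chi(\Pi_{F_4}^{(2)},t)&=1-50t+49t^2,\\ \chi(\Pi_{H_4}^{(2)},t)&=1-272t+271t^2,\\ \chi(\Pi_{E_6}^{(2)},t)&=1-120t+2739t^2-2620t^3,\\ \chi(\Pi_{E_7}^{(2)},t)&=1-336t+26229t^2-230014t^3,\\ \chi(\Pi_{E_8}^{(2)},t)&=1-1120t+332178t^2-18066280t^3+17735221t^4. \end{aligned}$$
   Context: For a finite Coxeter group $W$ of type $X_n$, $\Pi_W^{(2)}=\Pi_{X_n}^{(2)}$ is the poset, under inclusion, of parabolic subgroups of $W$ (pointwise stabilizers in $W$ of subspaces of the reflection representation) all of whose irreducible components have even rank; its minimum $\hat 0$ is the trivial subgroup. Its characteristic polynomial is $\chi(\Pi_W^{(2)},t)=\sum_{W'\in\Pi_W^{(2)}}\mu(\hat 0,W')\,t^{\mathrm{rk}(W')/2}$, where $\mu$ is the Möbius function of $\Pi_W^{(2)}$ and $\mathrm{rk}(W')$ is the rank of $W'$ as a Coxeter group. *)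

(* Defs.v *)
From Stdlib Require Import BinNat.
From HB Require Import structures.
From mathcomp Require Import all_boot all_order all_algebra all_fingroup.
From mathcomp Require Import mxrepresentation.
From mathcomp Require Import boolp reals trigo.

Set Implicit Arguments.
Unset Strict Implicit.
Unset Printing Implicit Defensive.

Import Order.TTheory GRing.Theory Num.Theory.
Local Open Scope ring_scope.

(* The edges (i, j, m), with m >= 3, of the Coxeter graphs; the nodes are       *)
(* numbered from 0, those of E_n following Bourbaki.                            *)
Variant exceptional_type := H3 | F4 | H4 | E6 | E7 | E8.

Definition cox_size (X : exceptional_type) : nat :=
  match X with H3 => 3 | F4 | H4 => 4 | E6 => 6 | E7 => 7 | E8 => 8 end.

Definition cox_edges (X : exceptional_type) : seq (nat * nat * nat) :=
  match X with
  | H3 => [:: (0, 1, 5); (1, 2, 3)]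
  | F4 => [:: (0, 1, 3); (1, 2, 4); (2, 3, 3)]
  | H4 => [:: (0, 1, 5); (1, 2, 3); (2, 3, 3)]
  | E6 => [:: (0, 2, 3); (2, 3, 3); (3, 4, 3); (4, 5, 3); (1, 3, 3)]
  | E7 => [:: (0, 2, 3); (2, 3, 3); (3, 4, 3); (4, 5, 3); (5, 6, 3); (1, 3, 3)]
  | E8 => [:: (0, 2, 3); (2, 3, 3); (3, 4, 3); (4, 5, 3); (5, 6, 3); (6, 7, 3);
              (1, 3, 3)]
  end%N.

Definition cox_entry (edges : seq (nat * nat * nat)) (i j : nat) : nat :=
  if i == j then 1%N else
  head 2%N [seq e.2 | e <- edges & (e.1 == (i, j)) || (e.1 == (j, i))].

Definition cox_matrix (X : exceptional_type) (i j : 'I_(cox_size X)) : nat :=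
  cox_entry (cox_edges X) i j.

Arguments cox_matrix X : clear implicits.

(* (W, s) is a Coxeter system with Coxeter matrix m: W has the presentation     *)
(* < s_i | (s_i s_j)^(m i j) = 1 >, the relations s_i^2 = 1 being those with    *)
(* i = j, since m i i = 1.                                                      *)
Definition coxeter_system (n : nat) (m : 'I_n -> 'I_n -> nat)
    (gT : finGroupType) (W : {group gT}) (s : 'I_n -> gT) : Prop :=
  [/\ <<[set s i | i : 'I_n]>>%g = W,
      forall i j, ((s i * s j) ^+ m i j = 1)%g
    & forall (rT : groupType) (t : 'I_n -> rT),
        (forall i j, ((t i * t j) ^+ m i j = 1)%g) ->
        exists2 f : gT -> rT,
          {in W &, {morph f : x y / (x * y)%g}} & forall i, f (s i) = t i].

Section ReflectionRepresentation.
Variables (R : realType) (n : nat) (m : 'I_n -> 'I_n -> nat).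

Definition cox_form : 'M[R]_n := \matrix_(i, j) - cos (pi / (m i j)%:R).

(* Vectors are rows, acted upon on the right: this is the matrix of             *)
(* v |-> v - 2 B(v, e_i) e_i, where B is the form above.                        *)
Definition simple_reflection (i : 'I_n) : 'M[R]_n :=
  1%:M - 2 *: (col i cox_form *m delta_mx 0 i).

Definition reflection_representation (gT : finGroupType) (W : {group gT})
    (s : 'I_n -> gT) (rW : mx_representation R W n) : Prop :=
  forall i, rW (s i) = simple_reflection i.

End ReflectionRepresentation.

(* Moebius function of the finite subset S of T partially ordered by le; the    *)
(* counter k bounds the length of chains, and #|S| is large enough.             *)
Section Mobius.
Variables (T : finType) (le : rel T) (S : {set T}).

Fixpoint mobius_rec (k : nat) (x y : T) : int :=
  if k is k'.+1 then
    if x == y then 1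
    else - \sum_(z in S | [&& le x z, le z y & z != y]) mobius_rec k' x z
  else 0.

Definition mobius (x y : T) : int := mobius_rec #|S| x y.

Hypotheses (le_refl : reflexive le) (le_anti : antisymmetric le).
Hypothesis le_trans : transitive le.

Let itv x y := [set z in S | le x z && le z y].

Let mobius_rec_itv k l x y : x \in S -> y \in S ->
  (#|itv x y| <= k)%N -> (#|itv x y| <= l)%N -> le x y ->
  mobius_rec k x y = mobius_rec l x y.
Proof.
move=> xS; elim: k l y => [|k IHk] [|l] y yS.
- by [].
- rewrite leqn0 cards_eq0 => /eqP i0 _ lexy.
  by have := in_set0 x; rewrite -i0 inE xS le_refl lexy.
- move=> _; rewrite leqn0 cards_eq0 => /eqP i0 lexy.
  by have := in_set0 x; rewrite -i0 inE xS le_refl lexy.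
move=> lek lel lexy /=; case: ifP => // _; congr (- _).
apply: eq_bigr => z /and4P[zS lexz lezy nzy].
have lt : (#|itv x z| < #|itv x y|)%N.
  apply/proper_card/properP; split; last first.
    exists y; rewrite !inE yS ?lexy ?le_refl //=.
    by apply: contra nzy => leyz; apply/eqP/le_anti; rewrite lezy.
  apply/subsetP => u; rewrite !inE => /and3P[-> -> leuz] /=.
  exact: le_trans leuz lezy.
by apply: IHk => //; rewrite -ltnS (leq_trans lt).
Qed.

Lemma mobius_eq1 x : x \in S -> mobius x x = 1.
Proof.
rewrite /mobius => xS; have : (0 < #|S|)%N by apply/card_gt0P; exists x.
by case: #|S| => //= k _; rewrite eqxx.
Qed.

Lemma mobius_lt x y : x \in S -> y \in S -> le x y -> x != y ->
  mobius x y = - \sum_(z in S | [&& le x z, le z y & z != y]) mobius x z.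
Proof.
have itvS z t : (#|itv z t| <= #|S|)%N.
  by apply: subset_leq_card; apply/subsetP => u /[!inE] /andP[].
move=> xS yS lexy nxy; rewrite {1}/mobius.
rewrite (@mobius_rec_itv _ #|S|.+1) ?(leqW (itvS _ _)) //=.
by rewrite (negPf nxy).
Qed.

End Mobius.

Section EvenParabolicPoset.
Variables (R : realType) (n : nat) (m : 'I_n -> 'I_n -> nat).
Variables (gT : finGroupType) (W : {group gT}) (s : 'I_n -> gT).
Variable rW : mx_representation R W n.

(* The subspace is given as the row space of a square matrix U.                 *)
Definition parabolic (P : {group gT}) : Prop :=
  exists U : 'M[R]_n, rstab rW U = P.

(* Every pointwise stabilizer P is conjugate in W to a standard parabolic       *)
(* <s_i : i in J>, and is a Coxeter group with generators the corresponding     *)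
(* conjugates of the s_i. So the rank of P is #|J| (which only depends on P),   *)
(* and its irreducible components correspond to the connected components of     *)
(* the subgraph of the Coxeter graph induced by J, the rank of a component      *)
(* being its number of vertices.                                                *)
Definition has_cox_generators (P : {group gT}) (J : {set 'I_n}) : bool :=
  [exists w in W, <<s @: J>>%g :^ w == P]%g.

Definition cox_edge (J : {set 'I_n}) : rel 'I_n :=
  [rel i j | [&& i \in J, j \in J & (2 < m i j)%N]].

Definition even_components (J : {set 'I_n}) : bool :=
  [forall i in J, ~~ odd #|[set j | connect (cox_edge J) i j]|].

Definition cox_rank (P : {group gT}) : nat :=
  if [pick J | has_cox_generators P J] is Some J then #|J| else 0%N.

Definition even_parabolics : {set {group gT}} :=
  [set P : {group gT} | `[< parabolic P >] &&
     [exists J, has_cox_generators P J && even_components J]].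

Definition mu (P Q : {group gT}) : int :=
  mobius (fun A B : {group gT} => A \subset B) even_parabolics P Q.

Definition char_poly2 : {poly int} :=
  \sum_(P in even_parabolics) mu 1%G P *: 'X^((cox_rank P)./2).

End EvenParabolicPoset.

(* Main.v *)
Require Import Defs.
From Stdlib Require Import BinNat BinInt.
From mathcomp Require Import all_boot all_order all_algebra all_fingroup.
From mathcomp Require Import mxrepresentation.
From mathcomp Require Import boolp reals trigo.
From mathcomp Require Import ssrZ zify ring lra.

(* Tits' argument (e_i w is a nonnegative combination of simple roots unless s_i   *)
(* shortens w) shows that the reflection representation is faithful and that the   *)
(* pointwise stabilizers are the conjugates of the standard parabolics W_K. Hence  *)
(* the poset consists of the conjugates of the W_K with K even, and mu(1, W_K^x)   *)
(* depends on K only. Counting the pairs (K, x) with W_K^x = Q gives, for every    *)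
(* function g,                                                                     *)
(*   sum_(Q <= W_J) g(Q) =                                                         *)
(*     sum_(K in J, K even) sum_(x in W_J) g(W_K^x) / (|W_K| |M(J, K)|)            *)
(* where M(J, K) is the set of the y in W_J that map the simple roots of K to      *)
(* simple roots of J. The orders of the W_J follow from the sizes of the orbits    *)
(* of the fundamental weights, and |M(J, K)| from a normal form for tuples of      *)
(* vectors under W_J: make the first vector dominant, then the second one          *)
(* dominant for the stabilizer of the first one, and so on. This turns the         *)
(* recursion for mu, and the coefficients of chi, into a finite computation in     *)
(* Z[theta], where theta = 2 cos (pi / 4) or 2 cos (pi / 5).                       *)

(** The number mu(1, P) depends only on the conjugacy class of P, so the defining recursion of the
    Moebius function becomes a triangular linear system indexed by the even subsets J of the Coxeter
    graph, with coefficients [index_ratio J K]. [sum_even_below] produces these coefficients by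
    double counting, [mu1_std_par] shows that any solution of the system is the Moebius function,
    and [coef_char_poly2] reads the polynomial off a solution. Hence the values in [mobius_table]
    may be guessed: it is enough to check that they solve the system.

    The geometry rests on [nonneg_act], which ties the sign of a root to the length function
    ([root_signP]). It yields the fundamental domain property [dominant_unique], so that stabilizers
    of dominant vectors are standard parabolics, and [conj_std_par]: two conjugate standard
    parabolics are matched by an element that maps the simple roots of one to those of the other.
    Finiteness of W makes the form nondegenerate ([bform_eq0]), so a vector is encoded faithfully by
    its pairings with the simple roots.

    The orders |W_J| come from orbit counting ([par_orderP]), and |M(J, K)| from comparing normal
    forms of tuples of roots ([canonP], [simple_maps_countP]). [coxeter_checkP] turns a successful
    run into the coefficients, and [exceptional_check] is that run. *)

Set Implicit Arguments.
Unset Strict Implicit.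
Unset Printing Implicit Defensive.

Import Order.TTheory GRing.Theory Num.Theory.
Local Open Scope ring_scope.
Local Delimit Scope Z_scope with BZ.

(** * The computation *)

(* The pair (a, b) stands for a + b theta, where theta^2 = p theta + q; a vector v *)
(* is given by the list of the 2 B(v, e_j). The matrix mt is the Coxeter matrix.   *)
(* Boolean connectives are written with [if] because [vm_compute] evaluates both   *)
(* arguments of [&&].                                                              *)
Section Computation.
Local Open Scope Z_scope.
Section Algorithm.
Variables (p q : Z) (n : nat) (mt : seq (seq nat)).

Definition qz := (Z * Z)%type.

Definition qsub (x y : qz) : qz := (x.1 - y.1, x.2 - y.2).

Definition qmul (x y : qz) : qz :=
  (x.1 * y.1 + q * (x.2 * y.2),
   x.1 * y.2 + (x.2 * y.1 + p * (x.2 * y.2))).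

(* 2 (a + b theta) = X + Y sqrt D, where D = p^2 + 4 q.                            *)
Definition qneg (x : qz) : bool :=
  let X := (2 * x.1 + p * x.2) in
  let Y := x.2 in
  let XX := (X * X) in
  let DYY := ((p * p + 4 * q) * (Y * Y)) in
  if (X <? 0) then (if (Y <=? 0) then true else (DYY <? XX))
  else if (Y <? 0) then (XX <? DYY) else false.

Definition qeq (x y : qz) : bool :=
  if qneg (qsub x y) then false else ~~ qneg (qsub y x).

Definition mentry (i j : nat) : nat := nth 0%N (nth [::] mt i) j.

(** Twice the form on two simple roots joined by the label k. A label other than 1, 2, 3 is read as
    the one whose value is -theta. *)
Definition qcartan (k : nat) : qz :=
  match k with
  | 1%N => (2, 0) | 2%N => (0, 0) | 3%N => (-1, 0) | _ => (0, -1)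
  end.

Definition qroot (i : nat) : seq qz := [seq qcartan k | k <- nth [::] mt i].

Variable roots : seq (seq qz).

Definition qact (i : nat) (v : seq qz) : seq qz :=
  let c := nth (0, 0) v i in
  [seq qsub x.1 (qmul c x.2) | x <- zip v (nth [::] roots i)].

Fixpoint veq (u v : seq qz) : bool :=
  match u, v with
  | x :: u', y :: v' => if qeq x y then veq u' v' else false
  | [::], [::] => true
  | _, _ => false
  end.

Fixpoint vseq_eq (u v : seq (seq qz)) : bool :=
  match u, v with
  | x :: u', y :: v' => if veq x y then vseq_eq u' v' else false
  | [::], [::] => true
  | _, _ => false
  end.

Fixpoint vmem (u : seq qz) (s : seq (seq qz)) : bool :=
  if s is v :: s' then (if veq u v then true else vmem u s') else false.

Definition negatives (J : seq nat) (v : seq qz) : seq nat :=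
  [seq j <- J | qneg (nth (0, 0) v j)].

Fixpoint make_dominant (fl : nat) (J : seq nat) (v : seq qz)
    (vs : seq (seq qz)) : option (seq qz * seq (seq qz)) :=
  if negatives J v is j :: _ then
    if fl is f.+1 then make_dominant f J (qact j v) (map (qact j) vs)
    else None
  else Some (v, vs).

Variable fuel : nat.

Definition qwalls (J : seq nat) (v : seq qz) : seq nat :=
  [seq j <- J | qeq (nth (0, 0) v j) (0, 0)].

(* The list returned with the normal form is the set of generators of the          *)
(* stabilizer of the normal form.                                                  *)
Fixpoint canon (k : nat) (J : seq nat) (vs : seq (seq qz)) :
    option (seq (seq qz) * seq nat) :=
  match k, vs with
  | k'.+1, v :: vs' =>
    if make_dominant fuel J v vs' is Some (w, ws) then
      if canon k' (qwalls J w) ws is Some (us, I0) then Some (w :: us, I0)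
      else None
    else None
  | _, _ => Some ([::], J)
  end.

Fixpoint orbit_loop (fl : nat) (J : seq nat) (seen todo : seq (seq qz)) :
    option (seq (seq qz)) :=
  if todo is v :: todo' then
    if fl is f.+1 then
      let st := foldl (fun st j => let u := qact j v in
          if vmem u st.1 then st else (u :: st.1, u :: st.2)) (seen, todo') J in
      orbit_loop f J st.1 st.2
    else None
  else Some seen.

(** A multiple of the fundamental weight at h. For h in J its stabilizer in W_J is generated by the
    other nodes of J, which drives the recursion of [par_order]. *)
Definition unit_weight (h : nat) : seq qz :=
  [seq (if i == h then (1, 0) else (0, 0)) | i <- iota 0 n].

(* The order of W_J, or 0 if the fuel does not suffice.                            *)
Fixpoint par_order (J : seq nat) : Z :=
  if J is h :: J' then
    if orbit_loop fuel J [:: unit_weight h] [:: unit_weight h] is Some L then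
      (Z.of_nat (size L) * par_order J')
    else 0
  else 1.

Fixpoint compat (j k : nat) (t K : seq nat) : bool :=
  match t, K with
  | x :: t', y :: K' => if mentry j x == mentry k y then compat j k t' K' else false
  | _, _ => true
  end.

(** The candidate images of the simple roots of K: W preserves the form, so only tuples with the
    same labels can occur. *)
Fixpoint embeddings (K J : seq nat) : seq (seq nat) :=
  if K is k :: K' then
    [seq j :: t | t <- embeddings K' J, j <- [seq j <- J | compat j k t K']]
  else [:: [::]].

Definition canon_roots (J K : seq nat) := canon (size K) J (map (nth [::] roots) K).

Fixpoint subseqs (l : seq nat) : seq (seq nat) :=
  if l is j :: l' then let s := subseqs l' in map (cons j) s ++ s else [:: [::]].

Definition grow (l C : seq nat) : seq nat :=
  [seq j <- l | (j \in C) || has (fun k => 2 < mentry k j)%N C].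

Definition component (l : seq nat) (i : nat) : seq nat := iter n (grow l) [:: i].

Definition component_closed (l C : seq nat) : bool :=
  all (fun k => all (fun j => (2 < mentry k j)%N ==> (j \in C)) l) C.

Definition even_list (l : seq nat) : bool :=
  all (fun i => ~~ odd (size (component l i))) l.

(** That n rounds of growth exhaust a connected component is tested here rather than proved. *)
Definition even_list_check (full : seq nat) : bool :=
  all (fun l => all (fun i => component_closed l (component l i)) l) (subseqs full).

Variable order : seq nat -> Z.

(* |M(J, K)|, or 0 if the fuel does not suffice.                                   *)
Definition simple_maps_count (J K : seq nat) : Z :=
  if canon_roots J K is Some (us, I0) then
    let cs := [seq canon_roots J t | t <- embeddings K J] in
    if all (fun c => if c is Some _ then true else false) cs then
      Z.of_nat (count (fun c => if c is Some (us', _) then vseq_eq us us' else false) cs)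
      * order I0
    else 0
  else 0.

Variable phi : nat -> Z -> Z.

Definition fadd (x y : Z * Z) : Z * Z :=
  (x.1 * y.2 + y.1 * x.2, x.2 * y.2).

(* A fraction; the initial denominator makes it undefined (0) when [order J] is.   *)
Definition phi_sum (J : seq nat) (l : seq (seq nat)) : Z * Z :=
  let oJ := order J in
  foldr (fun K acc => let oK := order K in
      fadd (phi (size K) oK * oJ, oK * simple_maps_count J K) acc)
    (0, oJ) l.

(** Running out of fuel anywhere puts a factor 0 into the denominator, so a positive answer also
    certifies that the fuel sufficed. *)
Definition frac_is (x : Z * Z) (c : Z) : bool :=
  if (x.2 =? 0) then false else (x.1 =? c * x.2).

Definition sublist (K J : seq nat) : bool := all (fun k => k \in J) K.

Definition phi_check (evens : seq (seq nat)) : bool :=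
  all (fun J => frac_is (phi_sum J [seq K <- evens | sublist K J])
                        (if J is [::] then 1 else 0)) evens.

Definition coef_check (full : seq nat) (evens : seq (seq nat)) (cs : seq Z) : bool :=
  all (fun d => frac_is (phi_sum full [seq K <- evens | (size K)./2 == d])
                        (nth 0 cs d)) (iota 0 5).

End Algorithm.

Fixpoint assoc (T : Type) (d : seq nat -> T) (tbl : seq (seq nat * T)) l : T :=
  if tbl is (l', x) :: tbl' then if l == l' then x else assoc d tbl' l else d l.

Fixpoint lookup_phi (tbl : seq (nat * Z * Z)) (k : nat) (o : Z) : Z :=
  if tbl is (k', o', x) :: tbl' then
    if k == k' then (if (o =? o') then x else lookup_phi tbl' k o) else lookup_phi tbl' k o
  else 0.

(** The decreasing order makes [par_order] remove the last node first; for the full graph in types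
    E_6, E_7, E_8 the corresponding orbits have 27, 56 and 240 elements, within the fuel 300. The
    orders are tabulated once since they are looked up many times. *)
Definition coxeter_check p q n mt (tbl : seq (nat * Z * Z)) (cs : seq Z) : bool :=
  let roots := map (qroot mt) (iota 0 n) in
  let full := rev (iota 0 n) in
  let subs := subseqs full in
  let ord := par_order p q n roots 300 in
  let otbl := [seq (l, ord l) | l <- subs] in
  let order := assoc ord otbl in
  let evens := [seq l <- subs | even_list n mt l] in
  [&& even_list_check n mt full,
      phi_check p q mt roots 300 order (lookup_phi tbl) evens
    & coef_check p q mt roots 300 order (lookup_phi tbl) full evens cs].

End Computation.

(** * Exact arithmetic and signs in Z[theta] *)

Section QuadraticArithmetic.
Variables (R : realFieldType) (p q : Z) (th : R).

Definition zval (z : Z) : R := (int_of_Z z)%:~R.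

Lemma zvalD a b : zval (Z.add a b) = zval a + zval b.
Proof. by rewrite /zval -intrD -rmorphD. Qed.

Lemma zvalM a b : zval (Z.mul a b) = zval a * zval b.
Proof. by rewrite /zval -intrM -rmorphM. Qed.

Lemma zvalB a b : zval (Z.sub a b) = zval a - zval b.
Proof. by rewrite /zval -intrB -rmorphB. Qed.

Lemma zval_lt a b : (zval a < zval b) = Z.ltb a b.
Proof. rewrite /zval ltr_int; lia. Qed.

Lemma zval_le a b : (zval a <= zval b) = Z.leb a b.
Proof. rewrite /zval ler_int; lia. Qed.

Lemma zval_nat k : zval (Z.of_nat k) = k%:R.
Proof. by rewrite /zval (_ : int_of_Z _ = k) //; lia. Qed.

Definition qval (x : qz) : R := zval x.1 + zval x.2 * th.

Hypothesis thE : th ^+ 2 = zval p * th + zval q.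
Hypothesis th_ge : 0 <= 2 * th - zval p.

Lemma qval_sub x y : qval (qsub x y) = qval x - qval y.
Proof. by rewrite /qval /= !zvalB; ring. Qed.

Lemma qval_mul x y : qval (qmul p q x y) = qval x * qval y.
Proof.
rewrite /qval /= !(zvalD, zvalM).
have -> : (zval x.1 + zval x.2 * th) * (zval y.1 + zval y.2 * th) =
  zval x.1 * zval y.1 + (zval x.1 * zval y.2 + zval x.2 * zval y.1) * th
  + zval x.2 * zval y.2 * th ^+ 2 by ring.
by rewrite thE; ring.
Qed.

(** Twice the value is X + Y r with r = 2 theta - p nonnegative and r^2 = p^2 + 4 q. When X and Y
    have opposite signs, comparing X^2 with (Y r)^2 decides, and both are integers. *)
Lemma qneg_val x : qneg p q x = (qval x < 0).
Proof.
pose X := zval (Z.add (Z.mul 2 x.1) (Z.mul p x.2)); pose Y := zval x.2.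
pose r := 2 * th - zval p.
have r2 : r ^+ 2 = zval (Z.add (Z.mul p p) (Z.mul 4 q)).
  rewrite zvalD !zvalM (_ : zval 4 = 4) // /r.
  have -> : (2 * th - zval p) ^+ 2 = 4 * th ^+ 2 - 4 * zval p * th + zval p ^+ 2 by ring.
  by rewrite thE; ring.
have xE : 2 * qval x = X + Y * r.
  by rewrite /X /Y /r /qval zvalD !zvalM (_ : zval 2 = 2) //; ring.
have -> : (qval x < 0) = (X + Y * r < 0) by rewrite -xE pmulr_rlt0.
have r0 : 0 <= r by [].
have XX : zval (Z.mul (Z.add (Z.mul 2 x.1) (Z.mul p x.2)) (Z.add (Z.mul 2 x.1) (Z.mul p x.2))) = X ^+ 2.
  by rewrite zvalM expr2.
have DYY : zval (Z.mul (Z.add (Z.mul p p) (Z.mul 4 q)) (Z.mul x.2 x.2)) = (Y * r) ^+ 2.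
  by rewrite zvalM -r2 zvalM exprMn mulrC expr2.
rewrite /qneg -!zval_lt -zval_le XX DYY -/X -/Y (_ : zval 0 = 0) //.
have sq (a b : R) : 0 <= a -> 0 <= b -> (a ^+ 2 < b ^+ 2) = (a < b).
  by move=> a0 b0; rewrite ltr_pXn2r.
case: (ltP X 0) => X0.
  case: (leP Y 0) => Y0; first by apply/esym; have := mulr_le0_ge0 Y0 r0; lra.
  rewrite -(sqrrN X) sq; [| |lra]; last by rewrite mulr_ge0 // ltW.
  by apply/idP/idP; lra.
case: (ltP Y 0) => Y0; last first.
  by apply/esym/negbTE; rewrite -leNgt addr_ge0 // mulr_ge0.
rewrite -(sqrrN (Y * r)) sq //; last by rewrite oppr_ge0 nmulr_rle0.
by apply/idP/idP; lra.
Qed.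

Lemma qeq_val x y : qeq p q x y = (qval x == qval y).
Proof.
rewrite /qeq !qneg_val !qval_sub !subr_lt0 eq_le andbC.
by case: ltP => //= _; rewrite -leNgt ?andbT.
Qed.

End QuadraticArithmetic.

(** * Subsequences, embeddings and components as lists *)

Section Lists.
Implicit Types (J K l t : seq nat).

Lemma mem_subseqs l t : (t \in subseqs l) = subseq t l.
Proof.
elim: l t => [|j l IH] [|k t] /=; rewrite ?inE // mem_cat ?IH ?sub0seq ?orbT //.
case: eqVneq => [->|nkj]; rewrite -?IH.
  rewrite mem_map; last by move=> a b [].
  by rewrite IH; apply/orb_idr; rewrite !IH; exact/subseq_trans/subseq_cons.
by case: mapP => // -[t' _ [kj]]; rewrite kj eqxx in nkj.
Qed.

Lemma uniq_subseqs l : uniq l -> uniq (subseqs l).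
Proof.
elim: l => //= j l IH /andP[jl ul]; rewrite cat_uniq map_inj_uniq ?IH //; last first.
  by move=> a b [].
rewrite andbT; apply/hasPn => t; rewrite mem_subseqs => tl.
by apply: contra jl => /mapP[t' _ tE]; apply: (mem_subseq tl); rewrite tE mem_head.
Qed.

Variable mt : seq (seq nat).

Lemma compatP j k t K : size t = size K ->
  (forall a, (a < size K)%N -> mentry mt j (nth 0%N t a) = mentry mt k (nth 0%N K a)) ->
  compat mt j k t K.
Proof.
elim: t K => [|x t IH] [|y K] //= [szt] h; rewrite (h 0%N) // eqxx.
by apply: IH => // a; exact: (h a.+1).
Qed.

Lemma embeddings_sound K J t : t \in embeddings mt K J ->
  size t = size K /\ all (fun j => j \in J) t.
Proof.
elim: K t => [|k K IH] t /=; first by rewrite inE => /eqP->.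
case/allpairsPdep=> t' [j [t'E jJ ->]] /=; have [-> ->] := IH _ t'E.
by move: jJ; rewrite mem_filter => /andP[_ ->].
Qed.

Lemma embeddings_complete K J t : size t = size K -> all (fun j => j \in J) t ->
  (forall a b, (a < size K)%N -> (b < size K)%N ->
    mentry mt (nth 0%N t a) (nth 0%N t b) = mentry mt (nth 0%N K a) (nth 0%N K b)) ->
  t \in embeddings mt K J.
Proof.
elim: K t => [|k K IH] [|j t] //= [szt] /andP[jJ tJ] h.
apply/allpairsPdep; exists t, j; split=> //.
  by apply: IH => // a b aK bK; exact: (h a.+1 b.+1).
by rewrite mem_filter jJ compatP // => a aK; exact: (h 0%N a.+1).
Qed.

Lemma uniq_embeddings K J : uniq J -> uniq (embeddings mt K J).
Proof.
move=> uJ; elim: K => //= k K IH; apply: allpairs_uniq_dep => //.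
  by move=> t _; exact: filter_uniq.
by move=> [t j] [t' j'] _ _ /= [-> ->].
Qed.

Lemma component_ind n l i (P : seq nat -> Prop) :
  P [:: i] -> (forall C, P C -> P (grow mt l C)) -> P (component n mt l i).
Proof. by move=> P0 Pstep; rewrite /component; elim: n => //= N; exact: Pstep. Qed.

Lemma assoc_map (T : eqType) (d : seq nat -> T) (ls : seq (seq nat)) l :
  assoc d [seq (l', d l') | l' <- ls] l = d l.
Proof. by elim: ls => //= l' ls ->; case: eqP => [->|]. Qed.

End Lists.

(** * Coxeter groups *)

Section Coxeter.
Variables (R : realType) (n : nat) (m : 'I_n -> 'I_n -> nat).
Variables (gT : finGroupType) (W : {group gT}) (s : 'I_n -> gT).
Variable rW : mx_representation R W n.

Hypothesis m_diag : forall i, m i i = 1%N.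
Hypothesis m_gt1 : forall i j, i != j -> (1 < m i j)%N.
Hypothesis m_sym : forall i j, m i j = m j i.
Hypothesis genW : <<[set s i | i : 'I_n]>>%g = W.
Hypothesis relW : forall i j, ((s i * s j) ^+ m i j = 1)%g.
Hypothesis reflW : reflection_representation m s rW.

Implicit Types (i j : 'I_n) (J K : {set 'I_n}) (u v w : 'rV[R]_n) (x y : gT).

(** * The invariant form and the action of the generators *)

Definition simple_root i : 'rV[R]_n := delta_mx 0 i.
Local Notation e := simple_root.

Definition bform u v : R := (u *m cox_form R m *m v^T) 0 0.

Lemma bformDl u v w : bform (u + v) w = bform u w + bform v w.
Proof. by rewrite /bform !mulmxDl mxE. Qed.

Lemma bformZl a u w : bform (a *: u) w = a * bform u w.
Proof. by rewrite /bform -!scalemxAl mxE. Qed.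

Lemma bformC u v : bform u v = bform v u.
Proof.
have BT : (cox_form R m)^T = cox_form R m.
  by apply/matrixP => i j; rewrite !mxE m_sym.
rewrite /bform -[v in LHS]trmxK -[in LHS]BT -[u in LHS]trmxK -!trmx_mul.
by rewrite trmxK mxE mulmxA.
Qed.

Lemma bformDr u v w : bform w (u + v) = bform w u + bform w v.
Proof. by rewrite !(bformC w) bformDl. Qed.

Lemma bformZr a u w : bform w (a *: u) = a * bform w u.
Proof. by rewrite !(bformC w) bformZl. Qed.

Lemma bformNl u w : bform (- u) w = - bform u w.
Proof. by rewrite -scaleN1r bformZl mulN1r. Qed.

Lemma bformNr u w : bform w (- u) = - bform w u.
Proof. by rewrite !(bformC w) bformNl. Qed.

Lemma bform_suml (I : Type) (r : seq I) (P : pred I) (F : I -> 'rV[R]_n) w :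
  bform (\sum_(k <- r | P k) F k) w = \sum_(k <- r | P k) bform (F k) w.
Proof.
apply: (big_morph (fun u => bform u w)) => [u v|]; first exact: bformDl.
by rewrite /bform !mul0mx mxE.
Qed.

Lemma bform_root i j : bform (e i) (e j) = - cos (pi / (m i j)%:R).
Proof. by rewrite /bform trmx_delta -rowE -colE !mxE. Qed.

Lemma bform_rootr v i : v *m col i (cox_form R m) = (bform v (e i))%:M.
Proof.
by rewrite [LHS]mx11_scalar /bform trmx_delta -mulmxA -colE.
Qed.

Lemma bform_root1 i : bform (e i) (e i) = 1.
Proof. by rewrite bform_root m_diag divr1 cospi opprK. Qed.

Lemma act_simple v i :
  v *m rW (s i) = v - (2 * bform v (e i)) *: e i.
Proof.
rewrite reflW mulmxBr mulmx1 -scalemxAr mulmxA bform_rootr mul_scalar_mx.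
by rewrite scalerA.
Qed.

Lemma gens_in i : s i \in W.
Proof. by rewrite -genW mem_gen // imset_f. Qed.
Hint Resolve gens_in : core.

Lemma actM v x y : x \in W -> y \in W ->
  v *m rW (x * y)%g = v *m rW x *m rW y.
Proof. by move=> xW yW; rewrite repr_mxM // mulmxA. Qed.

Lemma act1 v : v *m rW 1%g = v.
Proof. by rewrite repr_mx1 mulmx1. Qed.

Lemma gen_sqr i : (s i * s i = 1)%g.
Proof. by have := relW i i; rewrite m_diag expg1. Qed.

Lemma gen_inv i : ((s i)^-1 = s i)%g.
Proof. by apply/eqP; rewrite eq_invg_mul gen_sqr. Qed.

Lemma genK i x : (s i * (s i * x) = x)%g.
Proof. by rewrite mulgA gen_sqr mul1g. Qed.

Lemma act_root_self i : e i *m rW (s i) = - e i.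
Proof.
by rewrite act_simple bform_root1 mulr1 scaler_nat mulr2n opprD addNKr.
Qed.

Lemma bform_gen u v i : bform (u *m rW (s i)) (v *m rW (s i)) = bform u v.
Proof.
rewrite !act_simple !(bformDl, bformNl, bformZl, bformDr, bformNr, bformZr).
by rewrite bform_root1 (bformC (e i) v); ring.
Qed.

(** * Words and standard parabolic subgroups *)

Definition wprod (t : seq 'I_n) : gT := (\prod_(i <- t) s i)%g.

Lemma wprod_cons i t : wprod (i :: t) = (s i * wprod t)%g.
Proof. by rewrite /wprod big_cons. Qed.

Lemma wprod_cat t t' : wprod (t ++ t') = (wprod t * wprod t')%g.
Proof. by rewrite /wprod big_cat. Qed.

Lemma wprod_nil : wprod [::] = 1%g.
Proof. by rewrite /wprod big_nil. Qed.

Definition std_par J : {group gT} := generated_group (s @: J).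
Local Notation WJ := std_par.

Lemma std_parT : WJ setT = W.
Proof.
apply: val_inj; rewrite /= -genW; congr <<_>>%g.
by apply/setP=> x; apply/imsetP/imsetP=> -[i _ ->]; exists i; rewrite ?inE.
Qed.

Lemma std_par0 : WJ set0 = 1%G.
Proof. by apply: val_inj; rewrite /= imset0 gen0. Qed.

Lemma std_parS J K : J \subset K -> WJ J \subset WJ K.
Proof. by move=> JK; rewrite genS // imsetS. Qed.

Lemma std_par_sub J : WJ J \subset W.
Proof. by rewrite -std_parT std_parS ?subsetT. Qed.

Lemma gen_std_par J i : i \in J -> s i \in WJ J.
Proof. by move=> iJ; rewrite mem_gen // imset_f. Qed.

Lemma std_par_in J x : x \in WJ J -> x \in W.
Proof. exact: (subsetP (std_par_sub J)). Qed.

Lemma wprod_in J t : all [in J] t -> wprod t \in WJ J.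
Proof.
elim: t => [_|i t IH /= /andP[iJ tJ]]; first by rewrite wprod_nil group1.
by rewrite wprod_cons groupM ?gen_std_par ?IH.
Qed.

Lemma std_parP J x :
  reflect (exists2 t, all [in J] t & x = wprod t) (x \in WJ J).
Proof.
apply: (iffP idP) => [|[t tJ ->]]; last exact: wprod_in.
case/gen_prodgP=> k [c cJ ->].
have /fin_all_exists[d dP] : forall a, exists i, i \in J /\ c a = s i.
  by move=> a; have /imsetP[i iJ ->] := cJ a; exists i.
exists [seq d a | a <- enum 'I_k].
  by apply/allP=> _ /mapP[a _ ->]; case: (dP a).
rewrite /wprod big_map enumT; apply: eq_bigr => a _; by case: (dP a).
Qed.

Lemma std_par_ind J (P : gT -> Prop) :
    P 1%g -> (forall i x, i \in J -> x \in WJ J -> P x -> P (s i * x)%g) ->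
  forall x, x \in WJ J -> P x.
Proof.
move=> P1 PM x /std_parP[t tJ ->]; elim: t tJ => [|i t IH] /=.
  by rewrite wprod_nil.
case/andP=> iJ tJ; rewrite wprod_cons; apply: PM => //; last exact: IH.
exact: wprod_in.
Qed.

Lemma bform_act x u v : x \in W -> bform (u *m rW x) (v *m rW x) = bform u v.
Proof.
move: x u v; suff IH : forall x, x \in WJ setT -> forall u v,
    bform (u *m rW x) (v *m rW x) = bform u v.
  by move=> x u v xW; apply: IH; rewrite std_parT.
apply: std_par_ind => [u v|i x _ /std_par_in xW IH u v]; first by rewrite !act1.
by rewrite !actM ?gens_in // IH bform_gen.
Qed.


(** * Length, braid relations and positivity of roots *)

(** Length in the generators from J alone, so that it never has to be compared with the length in W;
    the value is 0 outside W_J. *)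
Definition wlen J x : nat :=
  if pselect (exists k : nat, `[< exists2 t, all [in J] t & size t = k /\ wprod t = x >])
  is left ex then ex_minn ex else 0.

Lemma wlen_word J x : x \in WJ J ->
  exists t, [/\ all [in J] t, wprod t = x & size t = wlen J x].
Proof.
move=> /std_parP[t tJ ->]; rewrite /wlen; case: pselect => [ex|[]].
  by case: ex_minnP => k /asboolP[t' t'J [<- <-]] _; exists t'.
by exists (size t); apply/asboolP; exists t.
Qed.

Lemma wlen_le J t : all [in J] t -> (wlen J (wprod t) <= size t)%N.
Proof.
move=> tJ; rewrite /wlen; case: pselect => // ex.
by case: ex_minnP => k _; apply; apply/asboolP; exists t.
Qed.

Lemma wlen0 J x : x \in WJ J -> wlen J x = 0 -> x = 1%g.
Proof.
case/wlen_word=> t [_ <- st] l0; rewrite l0 in st.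
by rewrite (size0nil st) wprod_nil.
Qed.

(* The word i j i ... of length k.                                                 *)
Fixpoint alt i j (k : nat) : seq 'I_n :=
  if k is k'.+1 then i :: alt j i k' else [::].

Lemma size_alt i j k : size (alt i j k) = k.
Proof. by elim: k i j => //= k IH i j; rewrite IH. Qed.

Lemma alt_in J i j k : i \in J -> j \in J -> all [in J] (alt i j k).
Proof. by elim: k i j => //= k IH i j iJ jJ; rewrite iJ IH. Qed.

Lemma altS i j k : alt i j k.+1 = rcons (alt i j k) (if odd k then j else i).
Proof.
elim: k i j => // k IH i j; rewrite [LHS]/= [alt i j k.+1]/= rcons_cons.
by rewrite -[j :: _]/(alt j i k.+1) IH /= if_neg.
Qed.

Lemma alt_cat i j k l : exists2 t, alt i j (k + l) = alt i j k ++ t &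
  forall J, i \in J -> j \in J -> all [in J] t.
Proof.
elim: k i j => [|k IH] i j /=; first by exists (alt i j l) => // J; exact: alt_in.
by case: (IH j i) => t -> tJ; exists t => // J iJ jJ; exact: tJ.
Qed.

(** The two alternating words of length k differ by the factor (s_i s_j)^k, which is trivial for k =
    m i j. *)
Lemma braid i j : wprod (alt i j (m i j)) = wprod (alt j i (m i j)).
Proof.
have inv1 : (s i * s j * s i * (s i * s j) = s i)%g.
  by rewrite -!mulgA genK gen_sqr mulg1.
have inv k : ((s i * s j) ^+ k * s i * (s i * s j) ^+ k = s i)%g.
  move: inv1; set r := (s i * s j)%g => inv1.
  elim: k => [|k IH]; first by rewrite expg0 mulg1 mul1g.
  by rewrite {1}expgSr expgS -[RHS]IH -{2}inv1 !mulgA.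
have eqw k : wprod (alt i j k) = ((s i * s j) ^+ k * wprod (alt j i k))%g.
  elim: k => [|k IH]; first by rewrite expg0 mul1g.
  rewrite [alt i j _]/= [alt j i _]/= !wprod_cons expgSr IH.
  by rewrite -!mulgA genK !mulgA inv.
by rewrite eqw relW mul1g.
Qed.

Definition nonneg v := forall i, 0 <= v 0 i.

Lemma nonnegD u v : nonneg u -> nonneg v -> nonneg (u + v).
Proof. by move=> u0 v0 i; rewrite mxE addr_ge0. Qed.

Lemma nonnegZ a v : 0 <= a -> nonneg v -> nonneg (a *: v).
Proof. by move=> a0 v0 i; rewrite mxE mulr_ge0. Qed.

Lemma nonneg_root i : nonneg (e i).
Proof. by move=> j; rewrite mxE ler0n. Qed.

(** In the plane of e_i and e_j each letter raises l by one, because sin((l+2)t) + sin(l t) = 2 cos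
    t sin((l+1)t). The resulting coefficients are nonnegative as long as the multiples of t do not
    exceed pi. *)
Lemma act_alt i j k l (t := pi / (m i j)%:R) : exists a b,
  (a == i) && (b == j) || (a == j) && (b == i) /\
  (sin (l.+1%:R * t) *: e i + sin (l%:R * t) *: e j) *m rW (wprod (alt j i k)) =
  sin ((l + k).+1%:R * t) *: e a + sin ((l + k)%:R * t) *: e b.
Proof.
rewrite {}/t; elim: k i j l => [|k IH] i j l.
  by exists i, j; rewrite !eqxx wprod_nil act1 addn0.
have := IH j i l.+1; rewrite (m_sym j i) => -[a [b [ab IHab]]].
exists a, b; split; first by rewrite orbC.
have altW : wprod (alt i j k) \in W.
  by apply: (@std_par_in setT); rewrite wprod_in // alt_in ?inE.
rewrite [alt j i _]/= wprod_cons actM ?gens_in // addnS -addSn -IHab.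
congr (_ *m _); rewrite act_simple bformDl !bformZl bform_root1 bform_root.
rewrite -addrA -scalerBl addrC; congr (_ *: _ + _ *: _).
have -> : l.+2%:R * (pi / (m i j)%:R) =
  l.+1%:R * (pi / (m i j)%:R) + pi / (m i j)%:R :> R by rewrite -natr1; ring.
have -> : l%:R * (pi / (m i j)%:R) =
  l.+1%:R * (pi / (m i j)%:R) - pi / (m i j)%:R :> R by rewrite -natr1; ring.
by rewrite !sinD sinN cosN; ring.
Qed.


(* A reduced word of x starts with some j <> i. Write x = d v, where d is the      *)
(* longest alternating word in j and i that starts a reduced word of x. Neither    *)
(* s_i nor s_j shortens v, and d is shorter than m j i since otherwise the braid   *)
(* relation would make a reduced word of x start with i.                           *)
Lemma nonneg_act J x i : x \in WJ J -> i \in J ->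
  (wlen J x <= wlen J (s i * x)%g)%N -> nonneg (e i *m rW x).
Proof.
move=> xJ iJ; move: {2}(wlen J x) (leqnn (wlen J x)) => N.
elim: N x i xJ iJ => [|N IH] x i xJ iJ lexN lesx.
  move: lexN; rewrite leqn0 => /eqP/(wlen0 xJ) ->.
  by rewrite act1; exact: nonneg_root.
have [[|j t] [tJ tx st]] := wlen_word xJ.
  by rewrite -tx wprod_nil act1; exact: nonneg_root.
have [jJ t'J] : j \in J /\ all [in J] t by apply/andP.
have neij : i != j.
  apply: contraTneq lesx => ->; rewrite -ltnNge -tx wprod_cons genK.
  by rewrite -wprod_cons tx -st ltnS wlen_le.
have mji : (1 < m j i)%N by rewrite m_gt1 // eq_sym.
pose Q k := `[< exists tv, [/\ all [in J] tv, x = wprod (alt j i k ++ tv)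
                            & (k + size tv)%N = wlen J x] >].
have exQ : exists k, Q k by exists 1%N; apply/asboolP; exists t.
have ubQ k : Q k -> (k <= wlen J x)%N.
  by move=> /asboolP[tv [_ _ <-]]; exact: leq_addr.
case: (ex_maxnP exQ ubQ) => k /asboolP[tv [tvJ xE sizeE]] kmax.
have k_gt0 : (0 < k)%N by apply: kmax; apply/asboolP; exists t.
have kJ l : all [in J] (alt j i l) by exact: alt_in.
have ltkm : (k < m j i)%N.
  rewrite ltnNge; apply/negP => lemk.
  have [r rE rJ] := alt_cat j i (m j i) (k - m j i).
  rewrite subnKC // in rE.
  have szr : size r = (k - m j i)%N.
    by have := congr1 size rE; rewrite size_cat !size_alt => ->; rewrite addKn.
  move: lesx; rewrite leqNgt => /negP[].
  have : x = wprod (alt i j (m j i) ++ (r ++ tv)).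
    by rewrite xE rE -catA wprod_cat braid -wprod_cat.
  rewrite -(prednK (ltnW mji)) [alt i j _]/= cat_cons wprod_cons => xE'.
  rewrite {1}xE' genK; apply: leq_ltn_trans (wlen_le _) _.
    by rewrite !all_cat alt_in // rJ.
  by rewrite !size_cat size_alt szr -sizeE; move: lemk (ltnW mji); clear; lia.
pose v := wprod tv; have vJ : v \in WJ J by exact: wprod_in.
have sv : wlen J v = size tv.
  apply/eqP; rewrite eqn_leq wlen_le //=.
  have [t' [t'J' t'v <-]] := wlen_word vJ.
  have := wlen_le (J := J) (t := alt j i k ++ t').
  rewrite all_cat kJ t'J' wprod_cat t'v -wprod_cat -xE size_cat size_alt -sizeE.
  by rewrite leq_add2l; exact.
(* A letter b that shortens v can neither continue the alternating prefix, by maximality of k, nor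
   equal its last letter, since it would cancel and shorten x. For b among i and j one of these two
   cases always holds. *)
have letter b : b \in J -> (wlen J (s b * v)%g < wlen J v)%N ->
    (b != if odd k then i else j) && (alt j i k != rcons (alt j i k.-1) b).
  move=> bJ ltb; have bvJ : (s b * v)%g \in WJ J by rewrite groupM ?gen_std_par.
  have [t' [t'J' t'v st']] := wlen_word bvJ; apply/andP; split; apply/eqP.
    move=> bE; suff : Q k.+1 by move/kmax; rewrite ltnn.
    have xt' : x = wprod (alt j i k.+1 ++ t').
      by rewrite altS -bE -cats1 !wprod_cat wprod_cons wprod_nil mulg1 t'v
                 -mulgA genK -wprod_cat.
    have := wlen_le (J := J) (t := alt j i k.+1 ++ t').
    rewrite all_cat kJ t'J' -xt' size_cat size_alt st' => /(_ isT) le1.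
    apply/asboolP; exists t'; split=> //.
    by move: le1 ltb sizeE; rewrite sv st'; clear; lia.
  move=> altE; have xt' : x = wprod (alt j i k.-1 ++ t').
    by rewrite xE altE cat_rcons !wprod_cat t'v wprod_cons.
  have := wlen_le (J := J) (t := alt j i k.-1 ++ t').
  rewrite all_cat kJ t'J' -xt' size_cat size_alt st' -sizeE => /(_ isT).
  by move: ltb k_gt0; rewrite sv; clear; lia.
have pos_letter b : (b == i) || (b == j) -> nonneg (e b *m rW v).
  move=> bij; have bJ : b \in J by case/orP: bij => /eqP->.
  apply: IH => //; first by move: lexN k_gt0; rewrite -sizeE sv; clear; lia.
  rewrite leqNgt; apply/negP => /(letter b bJ)/andP[].
  rewrite -{1}(prednK k_gt0) -[in alt _ _ k](prednK k_gt0) altS /=.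
  by case/orP: bij => /eqP->; case: (odd _) => /=; rewrite ?eqxx.
have [a [b [ab]]] := act_alt i j k 0.
rewrite mul1r mul0r sin0 scale0r addr0 add0n (m_sym i j) => actE.
set t0 := pi / _ in actE.
have mR : 0 < (m j i)%:R :> R by rewrite ltr0n ltnW.
have sin_ge0 l : (l <= m j i)%N -> 0 <= sin (l%:R * t0).
  move=> lm; apply: sin_ge0_pi; rewrite /t0 mulr_ge0 ?divr_ge0 ?pi_ge0 //=.
  by rewrite mulrA ler_pdivrMr // mulrC ler_wpM2l ?pi_ge0 // ler_nat.
have sin_gt0 : 0 < sin t0.
  apply: sin_gt0_pi; rewrite /t0 divr_gt0 ?pi_gt0 //=.
  by rewrite ltr_pdivrMr // -[X in X < _]mulr1 ltr_pM2l ?pi_gt0 // ltr1n.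
have -> : e i *m rW x = (sin t0)^-1 *: ((sin t0 *: e i) *m rW x).
  by rewrite -scalemxAl scalerA mulVf ?scale1r // gt_eqF.
apply: nonnegZ; first by rewrite invr_ge0 ltW.
rewrite xE wprod_cat actM ?(std_par_in (wprod_in (kJ k))) ?(std_par_in vJ) //.
rewrite actE mulmxDl -!scalemxAl.
have ij : nonneg (e i *m rW v) /\ nonneg (e j *m rW v).
  by split; apply: pos_letter; rewrite eqxx ?orbT.
have [pa pb] : nonneg (e a *m rW v) /\ nonneg (e b *m rW v).
  by case/orP: ab => /andP[/eqP-> /eqP->]; case: ij.
by apply: nonnegD; apply: nonnegZ => //; apply: sin_ge0 => //; exact: ltnW.
Qed.


(** * Signs of roots, faithfulness and nondegeneracy of the form *)

Lemma root_norm x i : x \in W -> bform (e i *m rW x) (e i *m rW x) = 1.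
Proof. by move=> xW; rewrite bform_act // bform_root1. Qed.

Lemma act_gen_neg x i : x \in W -> e i *m rW (s i * x)%g = - (e i *m rW x).
Proof. by move=> xW; rewrite actM ?gens_in // act_root_self mulNmx. Qed.

(** Since s_i negates e_i, [nonneg_act] applies to whichever of x and s_i x is not lengthened to the
    other's disadvantage: to x if it is the shorter one, and to s_i x otherwise. *)
Lemma root_signP J x i : x \in WJ J -> i \in J ->
  nonneg (e i *m rW x) /\ (wlen J x <= wlen J (s i * x)%g)%N \/
  nonneg (- (e i *m rW x)) /\ (wlen J (s i * x)%g < wlen J x)%N.
Proof.
move=> xJ iJ; case: leqP => lex; first by left; split; first exact: (@nonneg_act J).
right; split => //; have sxJ : (s i * x)%g \in WJ J by rewrite groupM ?gen_std_par.
rewrite -act_gen_neg ?(std_par_in xJ) //; apply: (@nonneg_act J) => //.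
by rewrite genK ltnW.
Qed.

Lemma nonneg_antisym v : nonneg v -> nonneg (- v) -> v = 0.
Proof.
move=> v0 v0'; apply/rowP => i; apply/eqP; rewrite eq_le mxE v0 andbT.
by have := v0' i; rewrite mxE oppr_ge0 => ->.
Qed.

Lemma root_neq0 x i : x \in W -> e i *m rW x != 0.
Proof.
move=> xW; apply/eqP => e0; have := root_norm i xW.
by rewrite e0 /bform !mul0mx mxE => /esym/eqP; rewrite oner_eq0.
Qed.

Lemma root_nonneg_excl x i : x \in W ->
  nonneg (e i *m rW x) -> nonneg (- (e i *m rW x)) -> False.
Proof.
by move=> xW p q; have := root_neq0 i xW; rewrite (nonneg_antisym p q) eqxx.
Qed.

Definition supp J v := forall i, i \notin J -> v 0 i = 0.

Lemma suppD J u v : supp J u -> supp J v -> supp J (u + v).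
Proof. by move=> uJ vJ i iJ; rewrite mxE uJ // vJ // addr0. Qed.

Lemma suppZ J a v : supp J v -> supp J (a *: v).
Proof. by move=> vJ i iJ; rewrite mxE vJ // mulr0. Qed.

Lemma suppN J v : supp J v -> supp J (- v).
Proof. by move=> vJ i iJ; rewrite mxE vJ // oppr0. Qed.

Lemma supp_root J i : i \in J -> supp J (e i).
Proof.
by move=> iJ k kJ; rewrite mxE eqxx; case: eqP kJ => // ->; rewrite iJ.
Qed.

Lemma supp_act_sub J v x : x \in WJ J -> supp J (v *m rW x - v).
Proof.
move=> xJ; move: x xJ v; apply: std_par_ind => [v|i x iJ xJ IH v].
  by rewrite act1 subrr => k _; rewrite mxE.
rewrite actM ?gens_in ?(std_par_in xJ) // act_simple.
rewrite -(subrKA (v - (2 * bform v (e i)) *: e i)); apply: suppD; first exact: IH.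
by rewrite addrAC subrr add0r; apply/suppN/suppZ/supp_root.
Qed.

Lemma supp_act J v x : x \in WJ J -> supp J v -> supp J (v *m rW x).
Proof.
by move=> xJ vJ; rewrite -(subrK v (_ *m _)); apply: suppD => //; exact: supp_act_sub.
Qed.

Lemma row_sum_root v : v = \sum_i v 0 i *: e i.
Proof. exact: row_sum_delta. Qed.

(** The first letter i of a nonempty reduced word of x shortens x, so x makes e_i negative and
    cannot fix it. *)
Lemma act_eq_gen1 x : x \in W -> (forall i, e i *m rW x = e i) -> x = 1%g.
Proof.
move=> xW fx; have xT : x \in WJ setT by rewrite std_parT.
have [[|i t] [_ tx st]] := wlen_word xT; first by rewrite -tx wprod_nil.
have [|[n0 _]] := root_signP xT (in_setT i).
  case=> _; rewrite leqNgt -{1}tx wprod_cons genK => /negP[].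
  by rewrite -st ltnS wlen_le //; apply/allP.
by have := @root_nonneg_excl x i xW; rewrite fx in n0 *; case=> //; exact: nonneg_root.
Qed.

Lemma act_inj x y : x \in W -> y \in W ->
  (forall i, e i *m rW x = e i *m rW y) -> x = y.
Proof.
move=> xW yW xy; apply/(mulIg y^-1)%g; rewrite mulgV; apply: act_eq_gen1.
  by rewrite groupM ?groupV.
by move=> i; rewrite actM ?groupV // xy -actM ?groupV // mulgV act1.
Qed.

Lemma actK x v : x \in W -> v *m rW x *m rW x^-1%g = v.
Proof. by move=> xW; rewrite -actM ?groupV // mulgV act1. Qed.

Lemma actKV x v : x \in W -> v *m rW x^-1%g *m rW x = v.
Proof. by move=> xW; rewrite -actM ?groupV // mulVg act1. Qed.

(* The sum of the e_i x over W vanishes because x and s_i x contribute opposite    *)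
(* terms.                                                                          *)
Lemma fixed_by_gens_eq0 v : (forall i, v *m rW (s i) = v) -> v = 0.
Proof.
move=> fv; have fvW x : x \in W -> v *m rW x = v.
  move=> xW; have : x \in WJ setT by rewrite std_parT.
  move: x {xW}; apply: std_par_ind => [|i x _ /std_par_in xW IH].
    exact: act1.
  by rewrite actM ?gens_in // fv.
have sum0 i : \sum_(x in W) e i *m rW x = 0.
  have : \sum_(x in W) e i *m rW x = - \sum_(x in W) e i *m rW x.
    rewrite [LHS](reindex_inj (mulgI (s i))) -sumrN.
    by apply: eq_big => x; rewrite groupMl ?gens_in // => xW; rewrite act_gen_neg.
  move/eqP; rewrite -addr_eq0 -mulr2n -scaler_nat scaler_eq0 pnatr_eq0 /=.
  by move/eqP.
have : \sum_(x in W) v *m rW x = 0.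
  rewrite (eq_bigr (fun x => \sum_i (v 0 i *: e i) *m rW x)); last first.
    by move=> x _; rewrite -mulmx_suml -row_sum_root.
  rewrite exchange_big big1 // => i _.
  by under eq_bigr do rewrite -scalemxAl; rewrite -scaler_sumr sum0 scaler0.
rewrite (eq_bigr (fun=> v)) // sumr_const -scaler_nat => /eqP.
by rewrite scaler_eq0 pnatr_eq0 eqn0Ngt cardG_gt0 => /eqP.
Qed.

(** A vector in the radical of the form is fixed by every simple reflection. *)
Lemma bform_eq0 v : (forall i, bform v (e i) = 0) -> v = 0.
Proof.
move=> v0; apply: fixed_by_gens_eq0 => i.
by rewrite act_simple v0 mulr0 scale0r subr0.
Qed.

Lemma bform_mx v i : bform v (e i) = (v *m cox_form R m) 0 i.
Proof. by rewrite /bform trmx_delta -colE !mxE. Qed.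

Lemma bform_inj u v : (forall i, bform u (e i) = bform v (e i)) -> u = v.
Proof.
move=> uv; apply/eqP; rewrite -subr_eq0; apply/eqP/bform_eq0 => i.
by rewrite bformDl bformNl uv subrr.
Qed.

Lemma cox_form_unit : cox_form R m \in unitmx.
Proof.
rewrite -row_free_unit -kermx_eq0; apply/eqP/row_matrixP => i; rewrite row0.
apply: bform_eq0 => j; rewrite bform_mx -row_mul mulmx_ker row0.
by rewrite mxE.
Qed.

Definition dual (f : 'I_n -> R) : 'rV[R]_n := (\row_i f i) *m invmx (cox_form R m).

Lemma bform_dual f i : bform (dual f) (e i) = f i.
Proof. by rewrite bform_mx mulmxKV ?cox_form_unit // mxE. Qed.


(** * The fundamental domain of a standard parabolic *)

Definition dominant J v := forall i, i \in J -> 0 <= bform v (e i).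

Definition walls J v : {set 'I_n} := [set i in J | bform v (e i) == 0].

Lemma bform_dominant J v u :
  dominant J v -> nonneg u -> supp J u -> 0 <= bform v u.
Proof.
move=> dv u0 uJ; rewrite bformC (row_sum_root u) bform_suml sumr_ge0 // => i _.
rewrite bformZl bformC; case: (boolP (i \in J)) => iJ.
  by rewrite mulr_ge0 ?dv.
by rewrite uJ // mul0r.
Qed.

Lemma act_walls J v x : x \in WJ (walls J v) -> v *m rW x = v.
Proof.
move: x; apply: std_par_ind => [|i x]; first exact: act1.
rewrite inE => /andP[_ /eqP v0] /std_par_in xW IH.
by rewrite actM ?gens_in // act_simple v0 mulr0 scale0r subr0.
Qed.

(** Induction on length. If i is the first letter of a reduced word of x, then e_i x is negative, so
    0 <= B(v, e_i) = B(v x, e_i x) <= 0. Thus i is a wall, s_i fixes v, and the letter can be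
    removed. *)
Lemma dominant_unique J v x : x \in WJ J ->
  dominant J v -> dominant J (v *m rW x) -> x \in WJ (walls J v).
Proof.
move=> xJ; move: {2}(wlen J x) (leqnn (wlen J x)) => N.
elim: N x xJ => [|N IH] x xJ lexN dv dvx.
  by move: lexN; rewrite leqn0 => /eqP/(wlen0 xJ) ->; rewrite group1.
have [[|i t] [tJ tx st]] := wlen_word xJ.
  by rewrite -tx wprod_nil group1.
have [iJ t'J] : i \in J /\ all [in J] t by apply/andP.
have xE : x = (s i * wprod t)%g by rewrite -tx wprod_cons.
have yJ : wprod t \in WJ J by exact: wprod_in.
have lty : (wlen J (wprod t) < wlen J x)%N by rewrite -st ltnS wlen_le.
have [|[n0 _]] := root_signP xJ iJ.
  by case=> _; rewrite xE genK leqNgt -xE lty.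
have xW := std_par_in xJ; have yW := std_par_in yJ.
have v0 : bform v (e i) = 0.
  apply/eqP; rewrite eq_le dv // andbT -(bform_act _ _ xW) -oppr_ge0 -bformNr.
  apply: (bform_dominant dvx n0); apply: suppN; apply: supp_act => //.
  exact: supp_root.
rewrite xE groupM //; first by rewrite gen_std_par // inE iJ v0 eqxx.
apply: IH => //; first by rewrite -ltnS (leq_trans lty).
by move: dvx; rewrite xE actM ?gens_in // act_simple v0 mulr0 scale0r subr0.
Qed.

Lemma dominant_act_eq J v x : x \in WJ J ->
  dominant J v -> dominant J (v *m rW x) -> v *m rW x = v.
Proof. by move=> xJ dv dvx; apply: (@act_walls J); exact: dominant_unique. Qed.

Lemma stab_dominant J v x : dominant J v -> x \in WJ J ->
  (v *m rW x == v) = (x \in WJ (walls J v)).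
Proof.
move=> dv xJ; apply/eqP/idP => [vx|]; last exact: act_walls.
by apply: dominant_unique => //; rewrite vx.
Qed.

Lemma walls_sub J v : walls J v \subset J.
Proof. by apply/subsetP => i; rewrite inE => /andP[]. Qed.

Lemma dominant_ex J v : exists2 x, x \in WJ J & dominant J (v *m rW x).
Proof.
(* As h pairs to 1 with every simple root, reflecting in a negative wall increases the pairing with
   h; a maximum over the finite group is therefore dominant. *)
pose h := dual (fun=> 1); pose f x := bform (v *m rW x) h.
case: (@Order.TotalTheory.arg_maxP _ _ _ 1%g [in WJ J] f (group1 _)) => x xJ xmax.
exists x => // i iJ; rewrite leNgt; apply/negP => lt0.
have xW := std_par_in xJ.
have : f (x * s i)%g <= f x := xmax _ (groupM xJ (gen_std_par iJ)).
rewrite /f actM ?gens_in // act_simple bformDl bformNl bformZl.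
rewrite (bformC (e i)) bform_dual mulr1 leNgt => /negP[].
by rewrite ltrDl oppr_gt0 pmulr_rlt0.
Qed.

(** * Conjugacy of standard parabolics *)

Lemma refl_act x i v : x \in W ->
  v *m rW (s i ^ x)%g = v - (2 * bform v (e i *m rW x)) *: (e i *m rW x).
Proof.
move=> xW; rewrite conjgE !actM ?groupM ?groupV ?gens_in // act_simple.
rewrite mulmxBl actKV // -scalemxAl; congr (_ - (_ * _) *: _).
by rewrite -(bform_act _ _ xW) actKV.
Qed.

Lemma conj_gen_root x i j : x \in W -> e i *m rW x = e j -> (s i ^ x = s j)%g.
Proof.
move=> xW ij; apply: act_inj; rewrite ?groupJ ?gens_in // => k.
by rewrite refl_act // ij act_simple.
Qed.

(** The reflection moves its own root a by -2a, while W_K moves every vector within the span of the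
    simple roots of K. *)
Lemma refl_in_std_par K x i : x \in W -> (s i ^ x)%g \in WJ K ->
  supp K (e i *m rW x).
Proof.
move=> xW sK; have := supp_act_sub (e i *m rW x) sK.
rewrite refl_act // root_norm // mulr1 addrAC subrr sub0r -scaleNr.
move=> h k kK; have := h k kK; rewrite mxE => /eqP.
by rewrite mulf_eq0 oppr_eq0 pnatr_eq0 /= => /eqP.
Qed.

Lemma gen_in_std_par K i : (s i \in WJ K) = (i \in K).
Proof.
apply/idP/idP => [sK|]; last exact: gen_std_par.
have := @refl_in_std_par K 1%g i (group1 W); rewrite conjg1 act1 => /(_ sK) h.
by apply: contraT => /h; rewrite mxE !eqxx => /eqP; rewrite oner_eq0.
Qed.

Lemma std_par_inj K K' : WJ K = WJ K' -> K = K'.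
Proof. by move=> e; apply/setP => i; rewrite -!gen_in_std_par e. Qed.

Lemma wlenV J x : x \in WJ J -> wlen J x^-1%g = wlen J x.
Proof.
suff le y : y \in WJ J -> (wlen J y^-1%g <= wlen J y)%N.
  by move=> xJ; apply/eqP; rewrite eqn_leq le //= -{1}(invgK x) le ?groupV.
case/wlen_word=> t [tJ <- <-]; rewrite -(size_rev t).
suff -> : (wprod t)^-1%g = wprod (rev t) by apply: wlen_le; rewrite all_rev.
elim: t {tJ} => [|i t IH]; first by rewrite wprod_nil invg1.
by rewrite wprod_cons invMg IH rev_cons -cats1 wprod_cat wprod_cons wprod_nil
           mulg1 gen_inv.
Qed.

(* Two mutually inverse nonnegative matrices are monomial.                         *)
Lemma simple_perm K K' y : y \in W ->
  (forall k, k \in K -> nonneg (e k *m rW y) /\ supp K' (e k *m rW y)) ->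
  (forall k, k \in K' -> nonneg (e k *m rW y^-1%g)) ->
  forall k, k \in K -> exists2 k', k' \in K' & e k *m rW y = e k'.
Proof.
move=> yW posK posK' k kK; have [a0 aK'] := posK k kK.
set a := e k *m rW y in a0 aK' *.
have eE : e k = \sum_l a 0 l *: (e l *m rW y^-1%g).
  rewrite -[LHS](actK _ yW) -/a [a in LHS]row_sum_root mulmx_suml.
  by apply: eq_bigr => l _; rewrite -scalemxAl.
have [k' ak'] : exists k', a 0 k' != 0.
  case: (pickP (fun l => a 0 l != 0)) => [k' ?|a00]; first by exists k'.
  have := root_neq0 k yW; rewrite -/a (_ : a = 0) ?eqxx //.
  by apply/rowP => l; rewrite [RHS]mxE; have /negbFE/eqP := a00 l.
have k'K' : k' \in K' by apply: contraNT ak' => /aK' ->.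
pose b := e k' *m rW y^-1%g.
(* The vector e_k is a nonnegative combination of nonnegative vectors in which b has nonzero weight,
   so b is a multiple of e_k; its norm 1 then forces the factor 1. *)
have bl l : l != k -> b 0 l = 0.
  move=> lk; have := congr1 (fun v : 'rV_n => v 0 l) eE.
  rewrite summxE mxE (negPf lk) andbF => /esym/eqP.
  rewrite psumr_eq0 => [/allP/(_ k' (mem_index_enum _))|j _].
    by rewrite mxE mulf_eq0 (negPf ak') => /eqP.
  rewrite mxE; case: (boolP (j \in K')) => jK'; first by rewrite mulr_ge0 ?posK'.
  by rewrite aK' // mul0r.
have bE : b = b 0 k *: e k.
  apply/rowP => l; rewrite [RHS]mxE.
  have -> : e k 0 l = (l == k)%:R by rewrite mxE eqxx.
  by case: (eqVneq l k) => [->|/bl ->]; rewrite ?mulr1 ?mulr0.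
exists k' => //; rewrite -[RHS](actKV _ yW) -/b bE.
suff -> : b 0 k = 1 by rewrite scale1r.
apply/eqP; rewrite -sqrp_eq1 ?posK' // -[X in _ == X](root_norm k' (groupVr yW)).
by rewrite -/b [in X in _ == X]bE bformZl bformZr bform_root1 mulr1.
Qed.

(* An element of minimal length in W_K x permutes the simple roots.                *)
Lemma conj_std_par J K K' x : K \subset J -> K' \subset J -> x \in WJ J ->
    (WJ K :^ x = WJ K')%g ->
  exists2 y, y \in (WJ K :* x)%g &
    (forall k, k \in K -> exists2 k', k' \in K' & e k *m rW y = e k') /\
    (forall k, k \in K' -> exists2 k', k' \in K & e k *m rW y^-1%g = e k').
Proof.
move=> KJ K'J xJ xK; have xc : x \in (WJ K :* x)%g by exact: rcoset_refl.
case: (@arg_minnP _ x [in (WJ K :* x)%g] (wlen J) xc) => y yc ymin.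
have KJ' := subsetP (std_parS KJ); have K'J' := subsetP (std_parS K'J).
have [a aK yE] := rcosetP yc.
have yJ : y \in WJ J by rewrite yE groupM // KJ'.
have yW := std_par_in yJ.
have yK : (WJ K :^ y = WJ K')%g by rewrite yE conjsgM conjGid.
have yK' : (WJ K' :^ y^-1 = WJ K)%g by rewrite -yK conjsgK.
have pos1 k : k \in K -> nonneg (e k *m rW y).
  move=> kK; have kJ := subsetP KJ _ kK.
  have [[]//|[_]] := root_signP yJ kJ; rewrite ltnNge => /negP[].
  by apply: ymin; rewrite yE mulgA mem_rcoset mulgK groupM ?gen_std_par.
have supp1 k : k \in K -> supp K' (e k *m rW y).
  move=> kK; apply: refl_in_std_par => //.
  by rewrite -yK memJ_conjg gen_std_par.
have pos2 k : k \in K' -> nonneg (e k *m rW y^-1%g).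
  move=> kK; have kJ := subsetP K'J _ kK.
  have yVJ : y^-1%g \in WJ J by rewrite groupV.
  have [[]//|[_]] := root_signP yVJ kJ; rewrite ltnNge => /negP[].
  have -> : (s k * y^-1 = (y * s k)^-1)%g by rewrite invMg gen_inv.
  rewrite !wlenV ?groupM ?gen_std_par //; apply: ymin.
  have -> : (y * s k = s k ^ y^-1 * y)%g by rewrite conjgE invgK -!mulgA mulVg mulg1.
  rewrite {2}yE mulgA mem_rcoset mulgK groupM //.
  by rewrite -yK' memJ_conjg gen_std_par.
have supp2 k : k \in K' -> supp K (e k *m rW y^-1%g).
  move=> kK; apply: refl_in_std_par; first by rewrite groupV.
  by rewrite -yK' memJ_conjg gen_std_par.
exists y => //; split.
  by apply: simple_perm => // k kK; split; [exact: pos1 | exact: supp1].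
apply: simple_perm; rewrite ?groupV // => k kK; last by rewrite invgK; exact: pos1.
by split; [exact: pos2 | exact: supp2].
Qed.

Lemma root_inj : injective e.
Proof.
move=> i j ij; apply/eqP; have := congr1 (fun v : 'rV_n => v 0 i) ij.
by rewrite !mxE !eqxx /= eq_sym; case: eqP => // _ /eqP; rewrite oner_eq0.
Qed.

Lemma std_par_stab J K : K \subset J -> exists2 v, dominant J v & walls J v = K.
Proof.
move=> KJ; exists (dual (fun i => (i \notin K)%:R)).
  by move=> i _; rewrite bform_dual ler0n.
apply/setP => i; rewrite inE bform_dual pnatr_eq0 eqb0 negbK.
by case: (boolP (i \in K)) => [/(subsetP KJ) ->|]; rewrite ?andbF.
Qed.

Lemma act_conj v z p : z \in W -> p \in W ->
  v *m rW p *m rW (z ^ p)%g = v *m rW z *m rW p.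
Proof.
move=> zW pW; rewrite -!actM ?groupJ //; congr (_ *m rW _).
by rewrite conjgE mulKVg.
Qed.

(* W_K is the stabilizer of a vector v; a dominant representative of v x for the *)
(* action of W_J has a standard parabolic stabilizer in W_J.                     *)
Lemma sub_std_par J K x : x \in W -> (WJ K :^ x \subset WJ J)%g ->
  exists2 K' : {set 'I_n}, K' \subset J &
    exists2 u, u \in WJ J & (WJ K :^ x = WJ K' :^ u)%g.
Proof.
move=> xW KxJ; have [v dv wv] := @std_par_stab setT K (subsetT K).
have stabv z : z \in W -> (v *m rW z == v) = (z \in WJ K).
  by move=> zW; rewrite (@stab_dominant setT) ?wv ?std_parT.
have [u uJ du] := dominant_ex J (v *m rW x).
have uW := std_par_in uJ.
rewrite -actM // in du; set p := (x * u)%g in du.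
have pW : p \in W by rewrite groupM.
set v' := v *m rW p in du; exists (walls J v'); first exact: walls_sub.
exists u^-1%g; first by rewrite groupV.
have KpJ : (WJ K :^ p \subset WJ J)%g by rewrite conjsgM -(conjGid uJ) conjSg.
apply: (@conjsg_inj _ u); rewrite -conjsgM conjsgKV.
apply/setP=> z; apply/idP/idP => zK.
  have zJ := subsetP KpJ _ zK; rewrite -stab_dominant //.
  case/imsetP: zK => k kK ->; have kW := std_par_in kK.
  by rewrite /v' act_conj //; move: kK; rewrite -stabv // => /eqP->.
have zJ := subsetP (std_parS (walls_sub J v')) _ zK; have zW := std_par_in zJ.
have := stab_dominant du zJ; rewrite zK => /eqP v'z.
have zpW : (z ^ p^-1)%g \in W by rewrite groupJ ?groupV.
rewrite mem_conjg -stabv // -(inj_eq (can_inj (fun w => actK w pW))).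
by rewrite -act_conj // conjgKV v'z.
Qed.


(** * Rank and evenness as conjugacy invariants *)

Lemma root_perm_m y i j i' j' : y \in W ->
  e i *m rW y = e i' -> e j *m rW y = e j' -> m i j = m i' j'.
Proof.
move=> yW ii jj; have m_gt0 k l : (0 < m k l)%N.
  by case: (eqVneq k l) => [->|/m_gt1/ltnW//]; rewrite m_diag.
have in0pi k l : pi / (m k l)%:R \in `[0, pi : R].
  rewrite in_itv /= divr_ge0 ?pi_ge0 //= ler_pdivrMr ?ltr0n //.
  by rewrite -[leLHS]mulr1 ler_wpM2l ?pi_ge0 // ler1n.
have := bform_act (e i) (e j) yW; rewrite ii jj !bform_root => /oppr_inj.
move/(cos_inj (in0pi _ _) (in0pi _ _)); rewrite mulrC [RHS]mulrC.
have pi0 : (pi : R) != 0 by rewrite gt_eqF // pi_gt0.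
move/(mulIf pi0)/invr_inj/eqP; rewrite eqr_nat => /eqP.
by [].
Qed.

Lemma cox_edge_in K i j : cox_edge m K i j -> (i \in K) && (j \in K).
Proof. by case/and3P=> -> ->. Qed.

(** By [root_perm_m] the bijection between simple roots preserves labels, so it is an isomorphism of
    Coxeter graphs and matches their components. *)
Lemma even_components_conj K K' y : y \in W ->
    (forall k, k \in K -> exists2 k', k' \in K' & e k *m rW y = e k') ->
    (forall k, k \in K' -> exists2 k', k' \in K & e k *m rW y^-1%g = e k') ->
  even_components m K -> even_components m K'.
Proof.
move=> yW KK' K'K /'forall_implyP evK; apply/'forall_implyP => k' k'K'.
have mapP (A B : {set 'I_n}) z :
    (forall k, k \in A -> exists2 k', k' \in B & e k *m rW z = e k') ->
    exists f : 'I_n -> 'I_n, forall k, k \in A -> f k \in B /\ e k *m rW z = e (f k).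
  move=> AB; exists (fun k => odflt k [pick j | (j \in B) && (e k *m rW z == e j)]).
  move=> k /AB[j jB kj]; case: pickP => [l /andP[lB /eqP]//|/(_ j)].
  by rewrite jB kj eqxx.
have [f fP] := mapP _ _ _ KK'; have [g gP] := mapP _ _ _ K'K.
have fK k : k \in K -> g (f k) = k.
  move=> kK; have [fk kf] := fP k kK; have [gk] := gP _ fk.
  by rewrite -kf actK // => /root_inj.
have gK k : k \in K' -> f (g k) = k.
  move=> kK; have [fk kf] := gP k kK; have [gk] := fP _ fk.
  by rewrite -kf actKV // => /root_inj.
have homo (A B : {set 'I_n}) h z : z \in W ->
    (forall k, k \in A -> h k \in B /\ e k *m rW z = e (h k)) ->
    forall i j, connect (cox_edge m A) i j -> connect (cox_edge m B) (h i) (h j).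
  move=> zW hP i j /connectP[t pt ->]; elim: t i pt => //= l t IH i /andP[il pt].
  apply: connect_trans (IH _ pt); apply: connect1.
  have /andP[iA lA] := cox_edge_in il; have [hi ie] := hP i iA.
  have [hl le] := hP l lA; move: il; rewrite /cox_edge /= => /and3P[_ _].
  by rewrite hi hl /= (root_perm_m zW ie le).
have conn_in (A : {set 'I_n}) i j : i \in A -> connect (cox_edge m A) i j -> j \in A.
  move=> iA /connectP[t pt ->]; elim: t i iA pt => //= l t IH i iA /andP[il pt].
  by apply: IH pt; have /andP[] := cox_edge_in il.
have [gK' _] := gP _ k'K'.
have -> : [set j | connect (cox_edge m K') k' j] =
          f @: [set j | connect (cox_edge m K) (g k') j].
  apply/setP => j; rewrite inE; apply/idP/imsetP => [cj|[l]].
    have jK' := conn_in _ _ _ k'K' cj; exists (g j); last by rewrite gK.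
    rewrite inE; apply: (homo _ _ _ y^-1%g) cj => //; by rewrite groupV.
  rewrite inE => cl ->; rewrite -(gK _ k'K').
  by apply: (homo _ _ _ y) cl.
rewrite card_in_imset ?evK //; move=> a b; rewrite !inE => ca cb fab.
by rewrite -(fK a (conn_in _ _ _ gK' ca)) -(fK b (conn_in _ _ _ gK' cb)) fab.
Qed.

Lemma card_std_par_conj K K' y : y \in W ->
    (forall k, k \in K -> exists2 k', k' \in K' & e k *m rW y = e k') ->
  (#|K| <= #|K'|)%N.
Proof.
move=> yW KK'; pose f k := odflt k [pick j | (j \in K') && (e k *m rW y == e j)].
have fP k : k \in K -> f k \in K' /\ e k *m rW y = e (f k).
  move=> /KK'[j jB kj]; rewrite /f; case: pickP => [l /andP[lB /eqP]//|/(_ j)].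
  by rewrite jB kj eqxx.
have <- : #|f @: K| = #|K|.
  apply: card_in_imset => a b aK bK fab; apply: root_inj.
  rewrite -(actK (e a) yW) -(actK (e b) yW).
  by case: (fP _ aK) => _ ->; case: (fP _ bK) => _ ->; rewrite fab.
by apply/subset_leq_card/subsetP => _ /imsetP[k kK ->]; case: (fP _ kK).
Qed.

Lemma conj_std_par_invariant K K' x : x \in W -> (WJ K :^ x = WJ K')%g ->
  #|K| = #|K'| /\ even_components m K = even_components m K'.
Proof.
move=> xW xK; have xT : x \in WJ setT by rewrite std_parT.
have [y yx [KK' K'K]] := conj_std_par (subsetT K) (subsetT K') xT xK.
have yW : y \in W.
  by have [a aK ->] := rcosetP yx; rewrite groupM // (std_par_in aK).
have yVW : y^-1%g \in W by rewrite groupV.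
split; first by apply/eqP; rewrite eqn_leq (card_std_par_conj yW) // (card_std_par_conj yVW).
apply/idP/idP; first exact: even_components_conj yW KK' K'K.
by apply: even_components_conj yVW K'K _; rewrite invgK.
Qed.

Lemma mem_even_parabolics (P : {group gT}) :
  reflect (exists2 K, even_components m K & exists2 x, x \in W & (WJ K :^ x)%g = P)
          (P \in even_parabolics m s rW).
Proof.
rewrite inE; apply: (iffP andP) => [[_ /existsP[K /andP[/existsP[x]]]]|].
  by case/andP=> xW /eqP xP evK; exists K => //; exists x.
case=> K evK [x xW xP]; split; last first.
  apply/existsP; exists K; rewrite evK andbT; apply/existsP; exists x.
  by rewrite xW; apply/eqP.
apply/asboolP; have [v dv wv] := @std_par_stab setT K (subsetT K).
(* All rows of this matrix are v x, so its pointwise stabilizer is that of v x, namely W_K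
   conjugated by x. *)
exists (const_mx 1 *m (v *m rW x)); rewrite -xP; apply/setP => z.
have rowU A i : row i ((const_mx 1 : 'cV[R]_n) *m (v *m rW x) *m A) = v *m rW x *m A.
  rewrite !row_mul; congr (_ *m _); rewrite row_const.
  by rewrite (_ : const_mx 1 = 1%:M) ?mul1mx //; apply/matrixP => a b; rewrite !mxE !ord1.
have stabv y : y \in W -> (v *m rW y == v) = (y \in WJ K).
  by move=> yW; rewrite (@stab_dominant setT) ?wv ?std_parT.
have -> : (z \in rstab rW ((const_mx 1 : 'cV[R]_n) *m (v *m rW x))) =
          (z \in W) && (v *m rW x *m rW z == v *m rW x).
  rewrite inE; congr (_ && _); apply/eqP/eqP => [zU|zv]; last first.
    by rewrite -[LHS]mulmxA zv.
  apply/rowP => i; have := congr1 (fun A => row i A 0 i) zU.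
  by rewrite rowU row_mul row_const (_ : const_mx 1 = 1%:M) ?mul1mx //;
     apply/matrixP => a b; rewrite !mxE !ord1.
apply/andP/idP => [[zW /eqP zv]|zK].
  rewrite mem_conjg -stabv; last by rewrite groupJ ?groupV.
  rewrite -(inj_eq (can_inj (fun w => actK w xW))) -act_conj ?groupJ ?groupV //.
  by rewrite conjgKV zv.
have zW : z \in W.
  by case/imsetP: zK => k kK ->; rewrite groupJ // (std_par_in kK).
split=> //; case/imsetP: zK => k kK ->; have kW := std_par_in kK.
by rewrite act_conj //; move: kK; rewrite -stabv // => /eqP->.
Qed.

(** Conjugacy in W is replaced by conjugacy in W_J through [sub_std_par], so that the poset below
    W_J is described inside W_J. *)
Lemma mem_even_below J (P : {group gT}) :
  reflect (exists K, [/\ K \subset J, even_components m K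
             & exists2 x, x \in WJ J & (WJ K :^ x)%g = P])
          ((P \in even_parabolics m s rW) && (P \subset WJ J)).
Proof.
apply: (iffP andP) => [[/mem_even_parabolics[K evK [x xW xP]] PJ]|].
  rewrite -xP in PJ; have [K' K'J [u uJ KK']] := sub_std_par xW PJ.
  exists K'; split=> //; last by exists u; rewrite // -KK'.
  have xuW : (x * u^-1)%g \in W by rewrite groupM // groupV (std_par_in uJ).
  suff /(conj_std_par_invariant xuW)[_ <-] : (WJ K :^ (x * u^-1) = WJ K')%g by [].
  by rewrite conjsgM KK' conjsgK.
case=> K [KJ evK [x xJ xP]]; split.
  by apply/mem_even_parabolics; exists K => //; exists x => //; exact: std_par_in xJ.
by rewrite -xP -(conjGid xJ) conjSg std_parS.
Qed.

Lemma cox_rank_std_par K x : x \in W -> cox_rank W s (WJ K :^ x)%G = #|K| :> nat.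
Proof.
move=> xW; rewrite /cox_rank; case: pickP => [K' /existsP[w /andP[wW /eqP wK]]|].
  have xwW : (w * x^-1)%g \in W by rewrite groupM // groupV.
  suff /(conj_std_par_invariant xwW)[-> //] : (WJ K' :^ (w * x^-1) = WJ K)%g.
  by rewrite conjsgM wK conjsgK.
by move/(_ K)/negbT/existsPn/(_ x); rewrite xW /= eqxx.
Qed.


(** * Double counting of parabolics below W_J *)

Definition conj_pairs J (Q : {set gT}) : {set {set 'I_n} * gT} :=
  [set p : {set 'I_n} * gT | [&& p.1 \subset J, p.2 \in WJ J & (WJ p.1 :^ p.2 == Q)%g]].

Lemma card_conj_pairsJ J Q x : x \in WJ J ->
  #|conj_pairs J (Q :^ x)%g| = #|conj_pairs J Q|.
Proof.
move=> xJ; have inj : injective (fun p : {set 'I_n} * gT => (p.1, p.2 * x^-1)%g).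
  by case=> [K y] [K' y'] [/= -> /mulIg ->].
rewrite -[RHS](card_preimset _ inj); congr #|pred_of_set _|; apply/setP => -[K y].
rewrite !inE /= groupMr ?groupV // conjsgM; congr [&& _, _ & _].
by rewrite -[RHS](inj_eq (@conjsg_inj _ x)) conjsgKV.
Qed.

Definition simple_maps J K : {set gT} :=
  [set y in WJ J | [forall k in K, [exists j in J, e k *m rW y == e j]]].

Lemma simple_mapsP J K y : reflect
    (y \in WJ J /\ forall k, k \in K -> exists2 j, j \in J & e k *m rW y = e j)
  (y \in simple_maps J K).
Proof.
rewrite inE; apply: (iffP andP) => -[yJ h]; split=> //.
  by move=> k kK; move/'forall_implyP/(_ k kK)/exists_inP: h => [j jJ /eqP]; exists j.
apply/'forall_implyP => k /h[j jJ kj]; apply/exists_inP; exists j => //.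
exact/eqP.
Qed.

Lemma conj_simple_map J K y : y \in simple_maps J K ->
  (WJ K :^ y)%g = WJ [set j in J | [exists k in K, e k *m rW y == e j]].
Proof.
case/simple_mapsP=> yJ yK; rewrite /= -genJ; congr <<_>>%g.
have yW := std_par_in yJ; apply/setP => z; apply/imsetP/imsetP.
  case=> _ /imsetP[k kK ->] ->; have [j jJ kj] := yK k kK.
  exists j; last exact: conj_gen_root.
  by rewrite inE jJ; apply/exists_inP; exists k; rewrite // kj.
case=> j; rewrite inE => /andP[jJ /exists_inP[k kK /eqP kj]] ->.
by exists (s k); [exact: imset_f | rewrite (conj_gen_root yW kj)].
Qed.

(** If z = a'^-1 a were not trivial, some e_k z with k in K would be negative. Then y, which sends
    simple roots of K to simple roots, would keep it negative, whereas y' = z y sends e_k to a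
    simple root. *)
Lemma simple_maps_repr J K a a' y y' : K \subset J ->
    a \in WJ K -> a' \in WJ K -> y \in simple_maps J K -> y' \in simple_maps J K ->
  (a * y = a' * y')%g -> a = a' /\ y = y'.
Proof.
move=> KJ aK a'K /simple_mapsP[yJ yK] /simple_mapsP[y'J y'K] ayE.
have yW := std_par_in yJ; have y'W := std_par_in y'J.
suff a'a : (a'^-1 * a = 1)%g.
  have aa' : a = a' by apply/(mulgI a'^-1)%g; rewrite a'a mulVg.
  by split=> //; move: ayE; rewrite aa' => /mulgI.
have zK : (a'^-1 * a)%g \in WJ K by rewrite groupM ?groupV.
have y'E : (y' = (a'^-1 * a) * y)%g by rewrite -mulgA ayE mulKg.
set z := (a'^-1 * a)%g in zK y'E *; have zW := std_par_in zK.
have [[|k t] [tK tz st]] := wlen_word zK; first by rewrite -tz wprod_nil.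
have [kK t'K] : k \in K /\ all [in K] t by apply/andP.
have [[_]|[n0 _]] := root_signP zK kK.
  by rewrite leqNgt -{1}tz wprod_cons genK -st ltnS wlen_le.
have [j _ y'j] := y'K k kK.
case: (@root_nonneg_excl y' k y'W); first by rewrite y'j; exact: nonneg_root.
rewrite y'E actM // -mulNmx (row_sum_root (- _)) mulmx_suml.
have suppz : supp K (- (e k *m rW z)).
  by apply/suppN/supp_act => //; exact: supp_root.
move=> l; rewrite summxE sumr_ge0 // => i _; rewrite -scalemxAl mxE.
case: (boolP (i \in K)) => iK; last by rewrite suppz // mul0r.
have [i' _ ->] := yK i iK.
by apply: mulr_ge0; [exact: n0 | exact: nonneg_root].
Qed.

(** For a pair (K', x), [conj_std_par] writes x^-1 as a y with a in W_K and y in M(J, K), uniquely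
    by [simple_maps_repr], and K' is recovered from y as the image of K. *)
Lemma card_conj_pairs_std J K : K \subset J ->
  #|conj_pairs J (WJ K)| = (#|WJ K| * #|simple_maps J K|)%N.
Proof.
move=> KJ; have KJ' := subsetP (std_parS KJ).
pose f (ay : gT * gT) :=
  ([set j in J | [exists k in K, e k *m rW ay.2 == e j]], (ay.1 * ay.2)^-1)%g.
have -> : conj_pairs J (WJ K) = f @: setX (WJ K) (simple_maps J K).
  apply/setP=> -[K' x]; apply/idP/imsetP => [|[[a y]]].
    rewrite inE /= => /and3P[K'J xJ /eqP xK].
    have xV : (WJ K :^ x^-1 = WJ K')%g.
      by apply: (@conjsg_inj _ x); rewrite conjsgKV; exact: esym xK.
    have xVJ : x^-1%g \in WJ J by rewrite groupV.
    have [y yx [KK' K'K]] := conj_std_par KJ K'J xVJ xV.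
    have [a aK yE] := rcosetP yx.
    have yJ : y \in WJ J by rewrite yE groupM // KJ'.
    have yM : y \in simple_maps J K.
      apply/simple_mapsP; split=> // k /KK'[k' k'K' kk']; exists k' => //.
      exact: (subsetP K'J).
    exists (a^-1, y)%g; first by rewrite inE /= groupV aK.
    rewrite /f /= yE mulKg invgK; congr (_, _); apply: std_par_inj.
    apply: val_inj; rewrite -[RHS]conj_simple_map -?yE //=.
    by rewrite yE conjsgM (conjGid aK).
  rewrite inE /= => /andP[aK yM] [-> ->].
  have [yJ _] := simple_mapsP _ _ _ yM.
  rewrite inE /= -conj_simple_map // groupV (groupM (KJ' _ aK) yJ) /=.
  rewrite invMg conjsgM conjsgK conjGid ?groupV // eqxx andbT.
  by apply/subsetP => j; rewrite inE => /andP[].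
rewrite -cardsX; apply: card_in_imset => -[a y] [a' y']; rewrite !in_setX /=.
move=> /andP[aK yM] /andP[a'K y'M] [_ /invg_inj].
by move/(simple_maps_repr KJ aK a'K yM y'M) => [-> ->].
Qed.

Lemma conj_pairs_neq0 J (Q : {group gT}) :
  Q \in even_parabolics m s rW -> Q \subset WJ J -> #|conj_pairs J Q|%:R != 0 :> rat.
Proof.
move=> QS QJ; rewrite pnatr_eq0 -lt0n; apply/card_gt0P.
have /mem_even_below[K [KJ _ [x xJ xK]]] :
  (Q \in even_parabolics m s rW) && (Q \subset WJ J) by rewrite QS.
by exists (K, x); rewrite inE /= KJ xJ xK eqxx.
Qed.

(** The value g Q is spread evenly over the pairs representing Q; their number is constant under
    conjugation by W_J. *)
Lemma sum_even_below J (g : {group gT} -> rat) :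
  \sum_(Q in even_parabolics m s rW | Q \subset WJ J) g Q =
  \sum_(K : {set 'I_n} | (K \subset J) && even_components m K)
    (\sum_(x in WJ J) g (WJ K :^ x)%G) / (#|WJ K| * #|simple_maps J K|)%:R.
Proof.
pose G (p : {set 'I_n} * gT) := g (WJ p.1 :^ p.2)%G / #|conj_pairs J (WJ p.1 :^ p.2)%g|%:R.
transitivity (\sum_(p : {set 'I_n} * gT |
    ((p.1 \subset J) && even_components m p.1) && (p.2 \in WJ J)) G p); last first.
  rewrite -(pair_big_dep (fun K : {set 'I_n} => (K \subset J) && even_components m K)
             (fun _ x => x \in WJ J) (fun K x => G (K, x))).
  apply: eq_bigr => K /andP[KJ _]; rewrite mulr_suml; apply: eq_bigr => x xJ.
  by rewrite /G card_conj_pairsJ // card_conj_pairs_std.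
rewrite (partition_big (fun p : {set 'I_n} * gT => (WJ p.1 :^ p.2)%G)
  (fun Q => (Q \in even_parabolics m s rW) && (Q \subset WJ J))); last first.
  case=> K x /= /andP[/andP[KJ evK] xJ]; apply/mem_even_below.
  by exists K; split=> //; exists x.
apply: eq_bigr => Q /andP[QS QJ].
(* Evenness of K is automatic for a pair representing an even Q, being a conjugacy invariant. *)
rewrite (eq_bigl [in conj_pairs J Q]); last first.
  case=> K x; rewrite inE /= [in RHS]/=.
  rewrite -(inj_eq val_inj) /=; case: eqP => [xQ|]; rewrite ?andbT ?andbF //.
  case: (boolP (K \subset J)) => //= KJ; case: (boolP (x \in WJ J)) => xJ; rewrite ?andbF //.
  rewrite andbT.
  have /mem_even_below[K0 [K0J evK0 [x0 x0J x0K]]] :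
    (Q \in even_parabolics m s rW) && (Q \subset WJ J) by rewrite QS.
  have xxW : (x0 * x^-1)%g \in W by rewrite groupM ?groupV ?(std_par_in x0J) ?(std_par_in xJ).
  suff /(conj_std_par_invariant xxW)[_ <-] : (WJ K0 :^ (x0 * x^-1) = WJ K)%g by [].
  by rewrite conjsgM x0K -xQ conjsgK.
rewrite (eq_bigr (fun=> g Q / #|conj_pairs J Q|%:R)); last first.
  case=> K x; rewrite inE /= => /and3P[_ _ /eqP xQ]; rewrite /G /= xQ.
  by congr (g _ / _); apply: val_inj.
by rewrite sumr_const -[RHS]mulr_natr divfK // conj_pairs_neq0.
Qed.


(** * The Moebius recursion as a linear system *)

Local Notation S := (even_parabolics m s rW).
Local Notation mu1 := (mu m s rW 1%G).

Lemma one_even_parabolic : 1%G \in S.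
Proof.
apply/mem_even_parabolics; exists set0.
  by apply/'forall_implyP => i; rewrite inE.
by exists 1%g => //; rewrite std_par0 conjs1g.
Qed.

Lemma mu1_sum (P : {group gT}) : P \in S ->
  \sum_(Q in S | Q \subset P) mu1 Q = (P == 1%G)%:R.
Proof.
move=> PS; rewrite (bigD1 P) ?PS ?subxx //=.
have le_refl : reflexive (fun A B : {group gT} => A \subset B).
  by move=> A; exact: subxx.
have le_anti : antisymmetric (fun A B : {group gT} => A \subset B).
  by move=> A B AB; apply: val_inj; apply/eqP; rewrite eqEsubset.
have le_trans : transitive (fun A B : {group gT} => A \subset B).
  by move=> A B C; exact: subset_trans.
case: eqVneq => [->|P1].
  rewrite {1}/mu mobius_eq1 ?one_even_parabolic // big1 ?addr0 // => Q.
  case/andP=> /andP[_ Q1]; case/eqP; apply: val_inj; apply/eqP.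
  by rewrite eqEsubset Q1 sub1G.
rewrite {1}/mu mobius_lt ?one_even_parabolic ?sub1G //; last by rewrite eq_sym.
apply/eqP; rewrite addrC subr_eq0; apply/eqP; apply: eq_bigl => Q.
by rewrite /= sub1G /= andbA.
Qed.

Lemma even_parabolicsJ (P : {group gT}) x : x \in W -> ((P :^ x)%G \in S) = (P \in S).
Proof.
suff imp Q y : y \in W -> Q \in S -> (Q :^ y)%G \in S.
  have PK : ((P :^ x) :^ x^-1)%G = P by apply: val_inj; exact: conjsgK.
  move=> xW; apply/idP/idP => [PxS|]; last exact: imp.
  by rewrite -PK imp ?groupV.
move=> yW /mem_even_parabolics[K evK [z zW zQ]]; apply/mem_even_parabolics.
by exists K => //; exists (z * y)%g; rewrite ?groupM // conjsgM zQ.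
Qed.

(** For K inside J this is the number of W_J-conjugates of W_K divided by the number of subsets of J
    whose parabolic is W_J-conjugate to W_K. Summing over K thus counts each subgroup once. *)
Definition index_ratio J K : rat :=
  #|WJ J|%:R / (#|WJ K| * #|simple_maps J K|)%:R.

(** The system is triangular for inclusion and its diagonal entry [index_ratio J J] is nonzero, so
    induction on the size of J identifies phi with the Moebius numbers. *)
Lemma mu1_std_par (phi : {set 'I_n} -> int) :
    (forall J, even_components m J ->
      \sum_(K : {set 'I_n} | (K \subset J) && even_components m K)
        (phi K)%:~R * index_ratio J K = (J == set0)%:R) ->
  forall J x, even_components m J -> x \in W -> mu1 (WJ J :^ x)%G = phi J.
Proof.
move=> phiP J; move: {2}#|J|.+1 (ltnSn #|J|) => N.
elim: N J => // N IH J ltJN x evJ xW.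
have IHJ K y : (K \subset J) && even_components m K -> K != J -> y \in W ->
    mu1 (WJ K :^ y)%G = phi K.
  move=> /andP[KJ evK] nKJ yW; apply: IH => //.
  rewrite -ltnS; apply: leq_trans ltJN; rewrite ltnS; apply: proper_card.
  by rewrite properEneq nKJ.
have J1 : ((WJ J :^ x)%G == 1%G) = (J == set0).
  apply/eqP/eqP => [/(congr1 val)/= J1|->]; last first.
    by apply: val_inj; rewrite std_par0 /= conjs1g.
  by apply: std_par_inj; rewrite std_par0; apply: val_inj; apply: (@conjsg_inj _ x);
     rewrite /= J1 conjs1g.
have := sum_even_below J (fun Q => (mu1 (Q :^ x)%G)%:~R).
(* Conjugation by x permutes the poset, so this is the Moebius recursion at the conjugate of W_J. *)
have -> : \sum_(Q in S | Q \subset WJ J) (mu1 (Q :^ x)%G)%:~R = (J == set0)%:R :> rat.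
  rewrite -J1 -rmorph_sum /=.
  have := @mu1_sum (WJ J :^ x)%G; rewrite even_parabolicsJ // => mu1J.
  rewrite -[RHS](rmorph_nat (intr : int -> rat)) -mu1J; last first.
    by apply/mem_even_parabolics; exists J => //; exists 1%g; rewrite ?conjsg1.
  congr (_%:~R); rewrite [RHS](reindex_inj (h := fun Q : {group gT} => (Q :^ x)%G)) /=.
    by apply: eq_bigl => Q; rewrite even_parabolicsJ // conjSg.
  by move=> P Q /(congr1 val) /= /conjsg_inj PQ; exact: val_inj.
have Jcond : (J \subset J) && even_components m J by rewrite subxx.
rewrite -(phiP J evJ) (bigD1 J) //= [in RHS](bigD1 J) //=.
set A := \sum_(K : {set 'I_n} | _) _; set B := \sum_(K : {set 'I_n} | _) _.
have -> : B = A.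
  apply: eq_bigr => K /andP[cK nKJ]; rewrite /index_ratio mulrA; congr (_ / _).
  rewrite (eq_bigr (fun=> (phi K)%:~R)) => [|y yJ]; last first.
    rewrite -(IHJ K (y * x)%g) ?groupM ?(std_par_in yJ) //.
    by congr (mu1 _)%:~R; apply: val_inj; rewrite /= conjsgM.
  by rewrite sumr_const -[(phi K)%:~R *+ _]mulr_natr.
move/addIr=> phiE.
have : (mu1 (WJ J :^ x)%G)%:~R * index_ratio J J = (phi J)%:~R * index_ratio J J.
  rewrite phiE (eq_bigr (fun=> (mu1 (WJ J :^ x)%G)%:~R)) => [|y yJ]; last first.
    by congr (mu1 _)%:~R; apply: val_inj; congr (_ :^ x)%g; exact: conjGid.
  by rewrite sumr_const -[(mu1 _)%:~R *+ _]mulr_natr -mulrA.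
have : index_ratio J J != 0.
  rewrite mulf_neq0 ?invr_eq0 ?pnatr_eq0 -?lt0n ?cardG_gt0 // muln_gt0 cardG_gt0.
  apply/card_gt0P; exists 1%g; apply/simple_mapsP; split; first exact: group1.
  by move=> k kJ; exists k; rewrite ?act1.
by move=> /mulIf h /h /eqP; rewrite eqr_int => /eqP.
Qed.

Lemma coef_char_poly2 (phi : {set 'I_n} -> int) d :
    (forall J, even_components m J ->
      \sum_(K : {set 'I_n} | (K \subset J) && even_components m K)
        (phi K)%:~R * index_ratio J K = (J == set0)%:R) ->
  ((char_poly2 m s rW)`_d)%:~R =
  \sum_(K : {set 'I_n} | even_components m K && (#|K|./2 == d))
    (phi K)%:~R * index_ratio setT K.
Proof.
move=> phiP; rewrite /char_poly2 coef_sum rmorph_sum /=.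
pose g Q : rat := (mu1 Q)%:~R * ((cox_rank W s Q)./2 == d)%:R.
rewrite (eq_bigl (fun Q => (Q \in S) && (Q \subset WJ setT))) => [|Q]; last first.
  apply/esym/andb_idr => /mem_even_parabolics[K _ [x xW <-]].
  by rewrite std_parT -(conjGid xW) conjSg std_par_sub.
rewrite (eq_bigr g) => [|Q _]; last first.
  by rewrite coefZ coefXn /g eq_sym intrM; case: eqP.
rewrite (sum_even_below setT g) [LHS](bigID (fun K : {set 'I_n} => #|K|./2 == d)) /=.
rewrite [X in _ + X]big1 ?addr0 => [|K /andP[/andP[_ evK] nK]]; last first.
  rewrite big1 ?mul0r // => x xT; have xW := @std_par_in setT x xT.
  by rewrite /g cox_rank_std_par // (negPf nK) mulr0.
apply: eq_big => [K|K /andP[/andP[_ evK] /eqP Kd]]; first by rewrite subsetT.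
rewrite /index_ratio mulrA; congr (_ / _).
rewrite (eq_bigr (fun=> (phi K)%:~R)) => [|x xT]; last first.
  have xW := @std_par_in setT x xT; rewrite /g cox_rank_std_par // Kd eqxx mulr1.
  by rewrite (mu1_std_par phiP).
by rewrite sumr_const -[(phi K)%:~R *+ _]mulr_natr.
Qed.


(** * Transporters of tuples and orbit counting *)

Definition transporter J (vs us : seq 'rV[R]_n) : {set gT} :=
  [set x in WJ J | [seq v *m rW x | v <- vs] == us].

Lemma card_transporter_act J x y vs us : x \in WJ J -> y \in WJ J ->
  #|transporter J [seq v *m rW x | v <- vs] [seq u *m rW y | u <- us]| =
  #|transporter J vs us|.
Proof.
move=> xJ yJ; have xW := std_par_in xJ; have yW := std_par_in yJ.
have inj : injective (fun z => x * z * y^-1)%g by move=> z z' /mulIg /mulgI.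
rewrite -[RHS](card_preimset _ inj); congr #|pred_of_set _|; apply/setP => z.
rewrite !inE groupMr ?groupV // groupMl //; case: (boolP (z \in _)) => //= zJ.
have zW := std_par_in zJ.
have injy : injective (fun v : 'rV[R]_n => v *m rW y).
  by move=> v v' /(congr1 (fun w => w *m rW y^-1%g)); rewrite !actK.
rewrite -[RHS](inj_eq (inj_map injy)).
rewrite -!map_comp; congr (_ == _); apply: eq_map => v /=.
by rewrite !actM ?groupM ?groupV // actKV.
Qed.

(** Dominant vectors in one W_J-orbit coincide, and the stabilizer of v is the parabolic of its
    walls, where the rest of the tuple is handled. *)
Lemma transporter_cons J v u vs us : dominant J v -> dominant J u ->
  transporter J (v :: vs) (u :: us) =
  if v == u then transporter (walls J v) vs us else set0.
Proof.
move=> dv du; apply/setP => x; rewrite inE /= eqseq_cons.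
have xw : x \in WJ (walls J v) -> x \in WJ J.
  exact: (subsetP (std_parS (walls_sub J v))).
case: (boolP (x \in WJ J)) => [xJ|xnJ] /=; last first.
  by case: eqP => _; rewrite inE //; apply/esym/negbTE; rewrite negb_and (contra xw).
case: (eqVneq v u) => [<-|nvu].
  by rewrite (stab_dominant dv xJ) [in RHS]inE.
rewrite inE; case: eqP => // vx; move: nvu.
by rewrite -vx (dominant_act_eq xJ dv) ?eqxx // vx.
Qed.

Lemma transporter_nil J : transporter J [::] [::] = WJ J.
Proof. by apply/setP => x; rewrite inE /= andbT. Qed.

(** Each element of M(J, K) transports the simple roots of K to exactly one tuple of L. *)
Lemma card_simple_maps J K (ks : seq 'I_n) (L : seq (seq 'I_n)) :
    ks =i K -> uniq L -> {in L, forall t, all [in J] t} ->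
    (forall t y, y \in WJ J -> all [in J] t ->
       [seq e k *m rW y | k <- ks] = [seq e j | j <- t] -> t \in L) ->
  #|simple_maps J K| = (\sum_(t <- L) #|transporter J (map e ks) (map e t)|)%N.
Proof.
move=> ksK uL LJ Lmax; under [RHS]eq_bigr do rewrite -sum1_card big_mkcond.
rewrite exchange_big -sum1_card big_mkcond; apply: eq_bigr => y _ /=.
rewrite -big_mkcond sum1_count.
case: (boolP (y \in simple_maps J K)) => [/simple_mapsP[yJ yK]|yM].
  pose f k := odflt k [pick j in J | e k *m rW y == e j].
  have fP k : k \in ks -> f k \in J /\ e k *m rW y = e (f k).
    rewrite ksK => /yK[j jJ kj]; rewrite /f; case: pickP => [l /andP[lB /eqP]//|/(_ j)].
    by rewrite jJ kj eqxx.
  have fE : [seq e k *m rW y | k <- ks] = [seq e j | j <- map f ks].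
    by rewrite -map_comp; apply/eq_in_map => k /fP[].
  have tL : map f ks \in L.
    by apply: (Lmax _ y) => //; apply/allP => _ /mapP[k kks ->]; case: (fP k kks).
  rewrite (eq_count (a2 := pred1 (map f ks))) ?count_uniq_mem ?tL // => t /=.
  by rewrite inE yJ /= -map_comp fE eq_sym (inj_eq (inj_map root_inj)).
rewrite (eq_in_count (a2 := pred0)) ?count_pred0 // => t /LJ/allP tJ.
apply: contraNF yM; rewrite inE -map_comp => /andP[yJ /eqP yt]; apply/simple_mapsP.
split=> // k; rewrite -ksK => kks; have : e k *m rW y \in map e t.
  by rewrite -yt; apply/mapP; exists k.
by case/mapP=> j jt ->; exists j => //; exact: tJ.
Qed.

Lemma card_orbit_stab J v (L : seq 'rV[R]_n) : uniq L -> v \in L ->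
    {in L, forall u, exists2 x, x \in WJ J & u = v *m rW x} ->
    {in L & J, forall u i, u *m rW (s i) \in L} ->
  #|WJ J| = (size L * #|transporter J [:: v] [:: v]|)%N.
Proof.
move=> uL vL reach closedL.
have inL x : x \in WJ J -> forall u, u \in L -> u *m rW x \in L.
  move: x; apply: std_par_ind => [u|i x iJ xJ IH u] uL'; first by rewrite act1.
  by rewrite actM ?gens_in ?(std_par_in xJ) // IH // closedL.
transitivity (\sum_(u <- L) #|transporter J [:: v] [:: u]|)%N.
  under [RHS]eq_bigr do rewrite -sum1_card big_mkcond.
  rewrite exchange_big -sum1_card big_mkcond; apply: eq_bigr => y _ /=.
  rewrite -big_mkcond sum1_count; case: ifPn => yJ.
    rewrite (eq_count (a2 := pred1 (v *m rW y))) ?count_uniq_mem ?inL // => u /=.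
    by rewrite inE yJ /= eqseq_cons andbT eq_sym.
  rewrite (eq_count (a2 := pred0)) ?count_pred0 // => u.
  by rewrite inE (negPf yJ).
rewrite (eq_big_seq (fun=> #|transporter J [:: v] [:: v]|)) => [|u uinL].
  by rewrite big_const_seq count_predT iter_addn_0 mulnC.
have [x xJ ->] := reach u uinL.
rewrite -[RHS](@card_transporter_act J 1%g x) ?group1 //=.
by rewrite act1.
Qed.


(** * Correctness of the computation *)

Section Correctness.
Variables (p q : Z) (mt : seq (seq nat)) (th : R) (fuel : nat).
Hypothesis thE : th ^+ 2 = zval R p * th + zval R q.
Hypothesis th_ge : 0 <= 2 * th - zval R p.
Hypothesis mtE : forall i j : 'I_n, mentry mt i j = m i j.
Hypothesis size_mt : forall i : 'I_n, size (nth [::] mt i) = n.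
Hypothesis cartE : forall i j, qval th (qcartan (m i j)) = - (2 * cos (pi / (m i j)%:R)).

Let roots := map (qroot mt) (iota 0 n).
Local Notation qv := (qval th).
Local Notation q0 := (Z0, Z0).

Definition decode (v : seq qz) : 'rV[R]_n := dual (fun i => qv (nth q0 v i) / 2).

Definition lset (l : seq nat) : {set 'I_n} := [set i | val i \in l].

Lemma bform_decode (v : seq qz) i : bform (decode v) (e i) = qv (nth q0 v i) / 2.
Proof. exact: bform_dual. Qed.

Lemma qval0 : qv q0 = 0.
Proof. by rewrite /qval (_ : zval R 0 = 0) // mul0r addr0. Qed.

Lemma nth_roots (i : 'I_n) : nth [::] roots i = qroot mt i.
Proof. by rewrite (nth_map 0%N) ?size_iota ?nth_iota ?add0n. Qed.

Lemma size_qroot (i : 'I_n) : size (qroot mt i) = n.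
Proof. by rewrite size_map size_mt. Qed.

Lemma nth_qroot (i j : 'I_n) : nth q0 (qroot mt i) j = qcartan (m i j).
Proof. by rewrite (nth_map 0%N) ?size_mt // -mtE. Qed.

Lemma decode_root (i : 'I_n) : decode (nth [::] roots i) = e i.
Proof.
apply: bform_inj => j; rewrite bform_decode nth_roots nth_qroot cartE bform_root.
by rewrite mulNr mulrAC divff ?mul1r // pnatr_eq0.
Qed.

Lemma size_qact (i : 'I_n) (v : seq qz) : size v = n -> size (qact p q roots i v) = n.
Proof. by move=> vn; rewrite size_map size_zip nth_roots size_qroot vn minnn. Qed.

Lemma decode_act (i : 'I_n) (v : seq qz) : size v = n ->
  decode (qact p q roots i v) = decode v *m rW (s i).
Proof.
move=> vn; apply: bform_inj => j; rewrite act_simple bformDl bformNl bformZl.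
rewrite !bform_decode (nth_map (q0, q0)); last first.
  by rewrite size_zip nth_roots size_qroot vn minnn.
rewrite nth_zip; last by rewrite nth_roots size_qroot.
rewrite /= nth_roots nth_qroot qval_sub (qval_mul thE) cartE bform_root.
by field.
Qed.

Lemma qneg_decode (v : seq qz) (i : 'I_n) : qneg p q (nth q0 v i) = (bform (decode v) (e i) < 0).
Proof. by rewrite (qneg_val thE th_ge) bform_decode pmulr_llt0 ?invr_gt0. Qed.

Lemma qeq0_decode (v : seq qz) (i : 'I_n) : qeq p q (nth q0 v i) q0 = (bform (decode v) (e i) == 0).
Proof.
rewrite (qeq_val thE th_ge) bform_decode qval0 mulf_eq0 invr_eq0.
by rewrite pnatr_eq0 orbF.
Qed.

Lemma veqP (u v : seq qz) : size u = size v ->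
  reflect (forall i : nat, qv (nth q0 u i) = qv (nth q0 v i)) (veq p q u v).
Proof.
elim: u v => [|x u IH] [|y v] //= => [_|[]/IH uv]; first by left.
rewrite (qeq_val thE th_ge); case: eqP => xy; last first.
  by right => /(_ 0%N).
by apply: (iffP uv) => [h [|i] //=|h i]; exact: (h i.+1).
Qed.

Lemma veq_decode (u v : seq qz) : size u = n -> size v = n ->
  veq p q u v = (decode u == decode v).
Proof.
move=> un vn; have uv : size u = size v by rewrite un.
apply/idP/eqP => [/(veqP uv) h|h]; first by apply: bform_inj => i; rewrite !bform_decode h.
apply/(veqP uv) => i.
have [lein|ltin] := leqP n i; first by rewrite !nth_default ?un ?vn.
have := congr1 (fun w => bform w (e (Ordinal ltin))) h; rewrite !bform_decode /=.
by move/divIf; apply; rewrite pnatr_eq0.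
Qed.

Definition wfv := all (fun v : seq qz => size v == n).

Lemma vmem_decode (u : seq qz) us : size u = n -> wfv us ->
  vmem p q u us = (decode u \in map decode us).
Proof.
move=> un; elim: us => //= v vs IH /andP[/eqP vn vsn].
by rewrite veq_decode // inE IH //; case: eqP.
Qed.

Definition wfl := all (fun j : nat => (j < n)%N).

Lemma wflP (l : seq nat) (j : nat) : wfl l -> j \in l -> exists2 i : 'I_n, j = i & i \in lset l.
Proof.
by move=> /allP wl jl; have jn := wl _ jl; exists (Ordinal jn); rewrite ?inE.
Qed.

Lemma lset_qwalls (J : seq nat) (v : seq qz) : lset (qwalls p q J v) = walls (lset J) (decode v).
Proof. by apply/setP => i; rewrite !inE mem_filter qeq0_decode andbC. Qed.

Lemma wfl_filter a (J : seq nat) : wfl J -> wfl (filter a J).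
Proof. by move=> /allP wJ; apply/allP => j; rewrite mem_filter => /andP[_ /wJ]. Qed.

Lemma make_dominantP f (J : seq nat) (v w : seq qz) vs ws : wfl J -> size v = n -> wfv vs ->
    make_dominant p q roots f J v vs = Some (w, ws) ->
  [/\ dominant (lset J) (decode w), size w = n, wfv ws &
    exists2 x, x \in WJ (lset J) & decode w = decode v *m rW x /\
      map decode ws = [seq u *m rW x | u <- map decode vs]].
Proof.
move=> wJ; elim: f v vs => [|f IH] v vs vn vsn /=; case negE: negatives => [|j l] //.
- case=> <- <-; split=> //; last first.
    by exists 1%g; rewrite ?group1 // act1 (eq_map act1) map_id.
  move=> i; rewrite inE => iJ; rewrite leNgt -qneg_decode; apply/negP => ni.
  have : val i \in negatives p q J v by rewrite mem_filter ni.
  by rewrite negE.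
- case=> <- <-; split=> //; last first.
    by exists 1%g; rewrite ?group1 // act1 (eq_map act1) map_id.
  move=> i; rewrite inE => iJ; rewrite leNgt -qneg_decode; apply/negP => ni.
  have : val i \in negatives p q J v by rewrite mem_filter ni.
  by rewrite negE.
have : j \in negatives p q J v by rewrite negE inE eqxx.
rewrite mem_filter => /andP[_ /(wflP wJ)[i -> iJ]].
have wfact : wfv (map (qact p q roots i) vs).
  by apply/allP => _ /mapP[u uvs ->]; rewrite size_qact // (eqP (allP vsn _ uvs)).
case/(IH _ _ (size_qact i vn) wfact) => dw wn wsn [x xJ [wx wsx]].
have xW := std_par_in xJ; split=> //; exists (s i * x)%g.
  by rewrite groupM ?gen_std_par.
rewrite actM ?gens_in // -decode_act //; split=> //.
rewrite wsx -!map_comp; apply/eq_in_map => u uvs /=.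
by rewrite actM ?gens_in // -decode_act // (eqP (allP vsn _ uvs)).
Qed.

(** Moving both tuples to normal form keeps the size of the transporter; [transporter_cons] then
    peels off one vector at a time, until only the stabilizer of the whole tuple is left. *)
Lemma canonP k (J : seq nat) vs vs' us us' I0 I0' : wfl J -> size vs = k -> size vs' = k ->
    wfv vs -> wfv vs' ->
    canon p q roots fuel k J vs = Some (us, I0) -> canon p q roots fuel k J vs' = Some (us', I0') ->
  #|transporter (lset J) (map decode vs) (map decode vs')| =
  if vseq_eq p q us us' then #|WJ (lset I0)| else 0%N.
Proof.
elim: k J vs vs' us us' I0 I0' => [|k IH] J [|v vs] [|v' vs'] us us' I0 I0' //= wJ.
  by move=> _ _ _ _ [<- <-] [<- _] /=; rewrite transporter_nil.
move=> [szvs] [szvs'] /andP[/eqP vn vsn] /andP[/eqP v'n vs'n].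
case md: make_dominant => [[w ws]|] //; case md': make_dominant => [[w' ws']|] //.
have [dw wn wsn [x xJ [wx wsx]]] := make_dominantP wJ vn vsn md.
have [dw' w'n ws'n [x' x'J [w'x' ws'x']]] := make_dominantP wJ v'n vs'n md'.
case cE: canon => [[us1 I1]|] //; case cE': canon => [[us1' I1']|] //.
move=> [<- <-] [<- _] /=.
rewrite -(card_transporter_act _ _ xJ x'J) /= -wx -w'x' -wsx -ws'x'.
rewrite transporter_cons // veq_decode //; case: eqP => ww; last by rewrite cards0.
have wE : qwalls p q J w' = qwalls p q J w.
  apply/eq_in_filter => j /(wflP wJ)[i -> _].
  by rewrite !qeq0_decode ww.
rewrite -lset_qwalls; apply: (IH _ _ _ _ _ _ I1') => //; rewrite ?wE //.
- exact: wfl_filter.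
- by have := congr1 size wsx; rewrite !size_map szvs.
- by have := congr1 size ws'x'; rewrite !size_map szvs'.
by rewrite -wE.
Qed.


(** * Orbit enumeration and the orders of parabolics *)

Section Orbit.
Variables (J : seq nat) (v0 : seq qz).
Hypothesis wJ : wfl J.

Definition orbit_closed (seen : seq (seq qz)) (v : seq qz) :=
  forall i, i \in lset J -> decode v *m rW (s i) \in map decode seen.

(** E exempts from closure the vector whose images are currently being added. *)
Definition orbit_inv (E : pred (seq qz)) (seen todo : seq (seq qz)) :=
  [/\ wfv seen, uniq (map decode seen), decode v0 \in map decode seen,
      {in map decode seen, forall u, exists2 x, x \in WJ (lset J) & u = decode v0 *m rW x} &
      {subset todo <= seen} /\
      forall v : seq qz, v \in seen -> (v \in todo) || E v \/ orbit_closed seen v].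

Lemma orbit_step E seen todo (v : seq qz) (i : 'I_n) : orbit_inv E seen todo ->
    v \in seen -> i \in lset J ->
    let u := qact p q roots i v in
    let st := if vmem p q u seen then (seen, todo) else (u :: seen, u :: todo) in
  [/\ orbit_inv E st.1 st.2, {subset seen <= st.1}
    & decode v *m rW (s i) \in map decode st.1].
Proof.
case=> wseen useen v0s reach [sub cl] vs iJ u st.
have vn : size v = n by apply/eqP; exact: (allP wseen).
have un : size u = n by exact: size_qact.
rewrite /st vmem_decode // -decode_act // -/u; case: ifPn => [uin|unin].
  by split.
split=> /=; last 1 first.
- by rewrite inE eqxx.
- split=> /=.
  + by rewrite un eqxx.
  + by rewrite unin.
  + by rewrite inE v0s orbT.
  + move=> w; rewrite inE => /orP[/eqP->|]; last exact: reach.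
    have [x xJ vx] := reach _ (map_f decode vs).
    exists (x * s i)%g; first by rewrite groupM ?gen_std_par.
    by rewrite actM ?gens_in ?(std_par_in xJ) // -vx decode_act.
  split.
    by move=> w; rewrite !inE => /orP[->//|/sub->]; rewrite orbT.
  move=> w; rewrite !inE => /orP[->|/cl[/orP[->|->]|clw]]; rewrite ?orbT; try by left.
  by right=> k kJ; rewrite inE clw ?orbT.
by move=> w ws; rewrite inE ws orbT.
Qed.

Lemma orbit_fold E seen todo (v : seq qz) (js : seq nat) : {subset js <= J} ->
    orbit_inv E seen todo -> v \in seen ->
    let st := foldl (fun st (j : nat) => let u := qact p q roots j v in
          if vmem p q u st.1 then st else (u :: st.1, u :: st.2)) (seen, todo) js in
  [/\ orbit_inv E st.1 st.2, {subset seen <= st.1}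
    & forall i : 'I_n, val i \in js -> decode v *m rW (s i) \in map decode st.1].
Proof.
elim: js seen todo => [|j js IH] seen todo jsJ inv vs /=; first by split.
have [i jE iJ] := wflP wJ (jsJ _ (mem_head _ _)).
have [] := orbit_step inv vs iJ; rewrite {}jE.
set st0 := if _ then _ else _; case: st0 => seen1 todo1 /= inv1 sub1 vi.
have [|inv2 sub2 vjs] := IH _ _ _ inv1 (sub1 _ vs).
  by move=> k kjs; apply: jsJ; rewrite inE kjs orbT.
split=> //; first by move=> w /sub1/sub2.
move=> k; rewrite inE => /orP[/eqP/val_inj->|]; last exact: vjs.
by case/mapP: vi => w /sub2 ws2 ->; exact: map_f.
Qed.

Lemma orbit_loopP fl seen todo L : orbit_inv pred0 seen todo ->
  orbit_loop p q roots fl J seen todo = Some L -> orbit_inv pred0 L [::].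
Proof.
elim: fl seen todo => [|fl IH] seen [|v todo] inv //=; try by case=> <-.
apply: IH; case: inv => wseen useen v0s reach [sub cl].
have vs : v \in seen by apply: sub; rewrite mem_head.
have inv : orbit_inv (pred1 v) seen todo.
  split=> //; split; first by move=> w wt; apply: sub; rewrite inE wt orbT.
  by move=> w /cl[|]; [rewrite inE orbF orbC; left | right].
have [//|[ws us v0s' reach' [sub' cl']] _ clv] := orbit_fold (js := J) _ inv vs.
set st := foldl _ _ _ in ws us v0s' reach' sub' cl' clv *.
split=> //; split=> // w /cl'[|]; last by right.
rewrite orbF; case/orP=> [->|/= /eqP->]; first by left.
by right=> i; rewrite inE; exact: clv.
Qed.

End Orbit.

Lemma size_unit_weight h : size (unit_weight n h) = n.
Proof. by rewrite size_map size_iota. Qed.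

Lemma bform_unit_weight (h i : 'I_n) : bform (decode (unit_weight n h)) (e i) = (i == h)%:R / 2.
Proof.
rewrite bform_decode (nth_map 0%N) ?size_iota // nth_iota // add0n.
rewrite -(inj_eq val_inj) /=; case: eqP => _; last by rewrite qval0.
by rewrite /qval (_ : zval R 1 = 1) // (_ : zval R 0 = 0) // mul0r addr0.
Qed.

Lemma par_orderP (J : seq nat) : uniq J -> wfl J -> par_order p q n roots fuel J <> Z0 ->
  par_order p q n roots fuel J = Z.of_nat #|WJ (lset J)|.
Proof.
elim: J => [|j J IH] /=.
  move=> _ _ _; have -> : lset [::] = set0 by apply/setP => i; rewrite !inE.
  by rewrite -[#|_|]/(#|gval (WJ set0)|) std_par0 cards1.
move=> /andP[jJ uJ] /andP[ltjn wJ]; case oE: orbit_loop => [L|] // nz.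
have -> : par_order p q n roots fuel J = Z.of_nat #|WJ (lset J)|.
  by apply: IH => // o0; apply: nz; rewrite o0; clear; lia.
have -> (a b : nat) : Z.mul (Z.of_nat a) (Z.of_nat b) = Z.of_nat (a * b)%N by clear; lia.
congr Z.of_nat.
pose h := Ordinal ltjn; rewrite -[j]/(val h) in jJ oE *.
have wJ' : wfl (val h :: J) by exact/andP.
have inv0 : orbit_inv (val h :: J) (unit_weight n h) pred0 [:: unit_weight n h] [:: unit_weight n h].
  split=> //=; rewrite ?mem_seq1 ?size_unit_weight ?eqxx //.
    by move=> u; rewrite inE => /eqP->; exists 1%g; rewrite ?group1 ?act1.
  by split=> // v vL; left; rewrite vL.
have [wL uL v0L reach [_ clL]] := orbit_loopP wJ' inv0 oE.
have dom : dominant (lset (val h :: J)) (decode (unit_weight n h)).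
  by move=> i _; rewrite bform_unit_weight divr_ge0 ?ler0n.
rewrite (card_orbit_stab uL v0L reach) => [|u i /mapP[v vL ->] iJ]; last first.
  by case: (clL v vL) => // /(_ i iJ).
rewrite transporter_cons // eqxx transporter_nil size_map; congr (_ * #|gval (WJ _)|)%N.
apply/setP => i; rewrite !inE bform_unit_weight mulf_eq0 invr_eq0 !pnatr_eq0 orbF.
rewrite eqb0 -(inj_eq val_inj) /=.
by case: eqP => [->|_] /=; rewrite ?andbT // (negPf jJ).
Qed.


(** * Counting simple maps by normal forms *)

Definition ords (t : seq nat) : seq 'I_n := pmap insub t.

Lemma val_ords (t : seq nat) : wfl t -> map val (ords t) = t.
Proof.
by elim: t => //= j t IH /andP[jn tn]; rewrite insubT /= IH.
Qed.

Lemma wfl_sub (t J : seq nat) : wfl J -> all (fun j : nat => j \in J) t -> wfl t.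
Proof. by move=> /allP wJ /allP tJ; apply/allP => j /tJ/wJ. Qed.

Lemma mem_ords (t : seq nat) i : wfl t -> (i \in ords t) = (i \in lset t).
Proof. by move=> wt; rewrite inE -[in RHS](val_ords wt) (mem_map val_inj). Qed.

Lemma decode_roots (t : seq nat) : wfl t ->
  map decode (map (nth [::] roots) t) = map e (ords t).
Proof.
move=> wt; rewrite -[in LHS](val_ords wt) -!map_comp; apply: eq_map => i /=.
exact: decode_root.
Qed.

Lemma wfv_roots (t : seq nat) : wfl t -> wfv (map (nth [::] roots) t).
Proof.
move=> wt; apply/allP => _ /mapP[j /(wflP wt)[i -> _] ->].
by rewrite nth_roots size_qroot.
Qed.

Lemma canon_subseq k (J : seq nat) vs us I0 :
  canon p q roots fuel k J vs = Some (us, I0) -> subseq I0 J.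
Proof.
elim: k J vs us I0 => [|k IH] J vs us I0 /=; first by case=> _ <-; exact: subseq_refl.
case: vs => [|v vs]; first by case=> _ <-; exact: subseq_refl.
case: make_dominant => [[w ws]|] //; case cE: canon => [[us1 I1]|] // [_ <-].
by apply: subseq_trans (IH _ _ _ _ cE) _; exact: filter_subseq.
Qed.

Lemma wfl_subseq (t J : seq nat) : subseq t J -> wfl J -> wfl t.
Proof. by move=> /mem_subseq tJ /allP wJ; apply/allP => j /tJ/wJ. Qed.

Variable order : seq nat -> Z.
Hypothesis orderP : forall J : seq nat, uniq J -> wfl J -> order J <> Z0 ->
  order J = Z.of_nat #|WJ (lset J)|.

Lemma simple_maps_countP (J K : seq nat) : uniq J -> wfl J -> uniq K -> wfl K ->
    simple_maps_count p q mt roots fuel order J K <> Z0 ->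
  simple_maps_count p q mt roots fuel order J K =
    Z.of_nat #|simple_maps (lset J) (lset K)|.
Proof.
move=> uJ wJ uK wK; rewrite /simple_maps_count.
case cK: canon_roots => [[us I0]|] //; case: ifP => // /allP allSome nz.
have I0J := canon_subseq cK.
have -> : order I0 = Z.of_nat #|WJ (lset I0)|.
  apply: orderP; [exact: subseq_uniq uJ|exact: wfl_subseq wJ|move=> o0; apply: nz].
  by rewrite o0; clear; lia.
have -> (a b : nat) : Z.mul (Z.of_nat a) (Z.of_nat b) = Z.of_nat (a * b)%N by clear; lia.
congr Z.of_nat.
have embJ t : t \in embeddings mt K J -> size t = size K /\ wfl t.
  by case/embeddings_sound=> -> /(wfl_sub wJ).
have uL : uniq (map ords (embeddings mt K J)).
  rewrite map_inj_in_uniq ?uniq_embeddings // => t t' /embJ[_ wt] /embJ[_ wt'].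
  by move/(congr1 (map val)); rewrite !val_ords.
rewrite (card_simple_maps (ks := ords K) _ uL) => [|i|t /mapP[t' t'E ->]|t y yJ tJ tE].
- rewrite big_map big_seq_cond.
  rewrite (eq_bigr (fun t => if (if canon_roots p q roots fuel J t is Some (us', _)
      then vseq_eq p q us us' else false) then #|WJ (lset I0)| else 0%N)).
    rewrite -big_seq_cond -big_mkcond /= big_const_seq iter_addn_0 mulnC.
    by rewrite count_map; congr (_ * _)%N; apply: eq_count.
  move=> t /andP[tE _]; have [szt wt] := embJ t tE.
  have := allSome _ (map_f (canon_roots p q roots fuel J) tE).
  case ct: canon_roots => [[us' I0']|] // _; rewrite -!decode_roots //.
  rewrite /canon_roots szt in ct.
  by apply: (canonP wJ _ _ _ _ cK ct); rewrite ?size_map ?wfv_roots.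
- by rewrite mem_ords.
- have [_ tJ] := embeddings_sound t'E; have [_ wt] := embJ _ t'E.
  apply/allP => i it; rewrite inE; apply: (allP tJ).
  by rewrite -(val_ords wt) map_f.
- have szo : size (ords K) = size K by rewrite -[in RHS](val_ords wK) size_map.
  have szt : size (map val t) = size K.
    by have := congr1 size tE; rewrite !size_map szo => ->.
  have -> : t = ords (map val t).
    apply: (inj_map val_inj); rewrite val_ords //.
    by apply/allP => _ /mapP[i _ ->]; exact: ltn_ord.
  apply: map_f; apply: embeddings_complete => //.
    by apply/allP => _ /mapP[i it ->]; have := allP tJ _ it; rewrite inE.
  move=> a b aK bK; have yW := std_par_in yJ.
  have szt' : size t = size K by rewrite -szt size_map.
  have i0 : 'I_n by move: aK; rewrite -szo; case: (ords K).
  have nthE c : (c < size K)%N -> e (nth i0 (ords K) c) *m rW y = e (nth i0 t c).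
    move=> cK'; have := congr1 (fun l => nth 0 l c) tE.
    by rewrite !(nth_map i0) ?szo ?szt'.
  rewrite -[K in RHS](val_ords wK) !(nth_map i0) ?szo ?szt' // !mtE.
  exact/esym/(root_perm_m yW (nthE a aK) (nthE b bK)).
Qed.


(** * Components and sums over subsets *)

Lemma mem_component (l : seq nat) (i : 'I_n) (k : nat) : wfl l -> i \in lset l ->
    k \in component n mt l i ->
  exists j, [/\ k = val j, j \in lset l & connect (cox_edge m (lset l)) i j].
Proof.
move=> wl il; move: k; apply: (@component_ind _ _ _ _ (fun C => forall k : nat, k \in C -> _)) => [k|C IH k].
  by rewrite inE => /eqP->; exists i.
rewrite mem_filter => /andP[/orP[/IH//|/hasP[k' /IH[j' [-> j'l ij']] edge]] kl].
have [j kj jl] := wflP wl kl; exists j; split=> //; apply: connect_trans ij' _.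
by apply: connect1; rewrite /cox_edge /= j'l jl -mtE -kj.
Qed.

Lemma component_complete (l : seq nat) (i j : 'I_n) : wfl l -> i \in lset l ->
    component_closed mt l (component n mt l i) ->
  connect (cox_edge m (lset l)) i j -> val j \in component n mt l i.
Proof.
move=> wl il closed /connectP[t pt ->].
have : val i \in component n mt l i.
  apply: (@component_ind _ _ _ _ (fun C => val i \in C)) => [|C iC]; first by rewrite inE.
  by rewrite mem_filter iC; move: il; rewrite inE.
set C := component _ _ _ _ in closed *; move: pt; elim: t (i) => //= k t IH i0.
case/andP=> /and3P[_ kl lt2] pt iC; apply: (IH k pt).
have kl' : val k \in l by move: kl; rewrite inE.
by move/allP: closed => /(_ _ iC)/allP/(_ _ kl'); rewrite mtE lt2.
Qed.

Lemma even_listP (l : seq nat) : uniq l -> wfl l ->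
    all (fun i : nat => component_closed mt l (component n mt l i)) l ->
  even_list n mt l = even_components m (lset l).
Proof.
move=> ul wl /allP closed.
have sizeE (i : 'I_n) : i \in lset l ->
    size (component n mt l i) = #|[set j | connect (cox_edge m (lset l)) i j]|.
  move=> il; have il' : val i \in l by move: il; rewrite inE.
  have wC : wfl (component n mt l i).
    by apply/allP => k /(mem_component wl il)[j [-> _ _]]; exact: ltn_ord.
  have uC : uniq (ords (component n mt l i)).
    rewrite -(map_inj_uniq val_inj) val_ords //.
    by apply: (@component_ind _ _ _ _ (uniq)) => // C _; exact: filter_uniq.
  rewrite -[in LHS](val_ords wC) size_map -(card_uniqP uC); apply: eq_card => j.
  rewrite mem_ords // !inE; apply/idP/idP.
    by case/(mem_component wl il)=> j' [/val_inj-> _].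
  by apply: component_complete => //; exact: closed.
apply/allP/'forall_implyP => [ev i il|ev k kl].
  by rewrite -sizeE // ev //; move: il; rewrite inE.
by have [i -> il] := wflP wl kl; rewrite sizeE // ev.
Qed.

Lemma sum_lset (P : pred {set 'I_n}) (F : {set 'I_n} -> rat) :
  \sum_(A : {set 'I_n} | P A) F A =
  \sum_(l <- subseqs (rev (iota 0 n)) | P (lset l)) F (lset l).
Proof.
set full := rev _; have ufull : uniq full by rewrite rev_uniq iota_uniq.
have infull (i : 'I_n) : val i \in full by rewrite mem_rev mem_iota /=.
rewrite -(big_map lset P F); apply: perm_big; apply: uniq_perm.
- exact: index_enum_uniq.
- rewrite map_inj_in_uniq ?uniq_subseqs // => l l'; rewrite !mem_subseqs.
  move=> /(subseq_uniqP ufull)-> /(subseq_uniqP ufull)-> ll'.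
  apply/eq_in_filter => j; rewrite mem_rev mem_iota /= => jn.
  have := congr1 (fun A : {set 'I_n} => Ordinal jn \in A) ll'.
  by rewrite !inE !mem_filter mem_rev mem_iota jn !andbT.
move=> A; rewrite mem_index_enum; apply/esym/mapP.
exists [seq j <- full | j \in [seq val i | i in A]].
  by rewrite mem_subseqs filter_subseq.
by apply/setP => i; rewrite inE mem_filter infull andbT (mem_image val_inj).
Qed.

Variable phi : nat -> Z -> Z.

Definition phi_set (A : {set 'I_n}) : int := int_of_Z (phi #|A| (Z.of_nat #|WJ A|)).

Lemma card_lset (l : seq nat) : uniq l -> wfl l -> #|lset l| = size l.
Proof.
move=> ul wl; rewrite -[in RHS](val_ords wl) size_map.
rewrite -(card_uniqP _); first by apply: eq_card => i; rewrite mem_ords.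
by rewrite -(map_inj_uniq val_inj) val_ords.
Qed.

Lemma zval_neq0 (z : Z) : z <> Z0 -> zval rat z != 0.
Proof. by move=> z0; rewrite /zval intr_eq0; apply/eqP; move: z0; clear; lia. Qed.

Lemma phi_sumP (J : seq nat) (ls : seq (seq nat)) : uniq J -> wfl J ->
    {in ls, forall t, uniq t && wfl t} ->
    (phi_sum p q mt roots fuel order phi J ls).2 <> Z0 ->
  zval rat (phi_sum p q mt roots fuel order phi J ls).1 /
    zval rat (phi_sum p q mt roots fuel order phi J ls).2 =
  \sum_(t <- ls) (phi_set (lset t))%:~R * index_ratio (lset J) (lset t).
Proof.
move=> uJ wJ; elim: ls => [|K ls IH] wls; first by rewrite big_nil mul0r.
rewrite big_cons [phi_sum _ _ _ _ _ _ _ _ (K :: ls)]/(fadd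
  (Z.mul (phi (size K) (order K)) (order J),
   Z.mul (order K) (simple_maps_count p q mt roots fuel order J K))
  (phi_sum p q mt roots fuel order phi J ls)) [_.1]/= [_.2]/= => nz.
have S2 : (phi_sum p q mt roots fuel order phi J ls).2 <> Z0.
  by move=> h; apply: nz; rewrite h; clear; lia.
have oK0 : order K <> Z0 by move=> h; apply: nz; rewrite h; clear; lia.
have cK0 : simple_maps_count p q mt roots fuel order J K <> Z0.
  by move=> h; apply: nz; rewrite h; clear; lia.
have oJ0 : order J <> Z0.
  move=> h; apply: S2; rewrite /phi_sum; elim: (ls) => //= ? ? ->.
  by clear; lia.
have /andP[uK wK] := wls K (mem_head _ _).
rewrite -IH // => [|K' K'ls]; last by apply: wls; rewrite inE K'ls orbT.
rewrite !(zvalD, zvalM) -addf_div ?mulf_neq0 ?zval_neq0 //; congr (_ + _).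
rewrite simple_maps_countP // (orderP uJ wJ oJ0) /phi_set card_lset //.
rewrite -(orderP uK wK oK0) mulrA; congr (_ / _).
  by rewrite zval_nat.
by rewrite (orderP uK wK oK0) !zval_nat natrM.
Qed.

End Correctness.

(** * From a successful check to the coefficients *)

Section Check.
Variables (p q : Z) (mt : seq (seq nat)) (th : R).
Hypothesis thE : th ^+ 2 = zval R p * th + zval R q.
Hypothesis th_ge : 0 <= 2 * th - zval R p.
Hypothesis mtE : forall i j : 'I_n, mentry mt i j = m i j.
Hypothesis size_mt : forall i : 'I_n, size (nth [::] mt i) = n.
Hypothesis cartE : forall i j, qval th (qcartan (m i j)) = - (2 * cos (pi / (m i j)%:R)).

Lemma frac_isP (x : Z * Z) (c : Z) : frac_is x c ->
  x.2 <> Z0 /\ zval rat x.1 / zval rat x.2 = zval rat c.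
Proof.
rewrite /frac_is; case: Z.eqb_spec => // x2 /Z.eqb_eq ->; split=> //.
by rewrite zvalM mulfK // zval_neq0.
Qed.

Lemma wfl_full : wfl (rev (iota 0 n)).
Proof. by apply/allP => j; rewrite mem_rev mem_iota. Qed.

Lemma lset_full : lset (rev (iota 0 n)) = setT.
Proof. by apply/setP => i; rewrite !inE mem_rev mem_iota ltn_ord. Qed.

Lemma coxeter_checkP tbl cs : (n < 10)%N -> (size cs <= 5)%N ->
    coxeter_check p q n mt tbl cs ->
  forall d, (char_poly2 m s rW)`_d = int_of_Z (nth Z0 cs d).
Proof.
move=> n10 szcs; rewrite /coxeter_check.
set full := rev _; set order := assoc _ _; set phi := lookup_phi tbl.
set subs := subseqs full; set evens := filter _ _.
have ufull : uniq full by rewrite rev_uniq iota_uniq.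
have orderP (J : seq nat) : uniq J -> wfl J -> order J <> Z0 -> order J = Z.of_nat #|WJ (lset J)|.
  by move=> uJ wJ; rewrite /order assoc_map; exact: (par_orderP thE th_ge mtE size_mt cartE).
have wsubs l : l \in subs -> uniq l && wfl l.
  rewrite mem_subseqs => lf; rewrite (subseq_uniq lf ufull) /=.
  exact: wfl_subseq lf wfl_full.
case/and3P=> /allP closed /allP phiC /allP coefC.
have evenE l : l \in subs -> even_list n mt l = even_components m (lset l).
  move=> lS; have /andP[ul wl] := wsubs l lS.
  by apply: even_listP => //; exact: closed.
have wevens (a : pred (seq nat)) : {in [seq t <- evens | a t], forall t, uniq t && wfl t}.
  by move=> K; rewrite !mem_filter => /and3P[_ _ /wsubs].
have sumE (P : pred {set 'I_n}) (a : pred (seq nat)) (F : {set 'I_n} -> rat) :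
    {in subs, forall t, a t = P (lset t)} ->
    \sum_(K : {set 'I_n} | P K && even_components m K) F K =
    \sum_(t <- [seq t <- evens | a t]) F (lset t).
  move=> aP; rewrite sum_lset -filter_predI big_filter.
  rewrite big_seq_cond [RHS]big_seq_cond; apply: eq_bigl => K /=.
  by case: (boolP (K \in subs)) => //= KS; rewrite aP // evenE.
have phi_eq (J : {set 'I_n}) : even_components m J ->
    \sum_(K : {set 'I_n} | (K \subset J) && even_components m K)
      (phi_set phi K)%:~R * index_ratio J K = (J == set0)%:R.
  have [l lS <-] : exists2 l, l \in subs & lset l = J.
    exists [seq j <- full | j \in [seq val i | i in J]].
      by rewrite mem_subseqs filter_subseq.
    apply/setP => i; rewrite inE mem_filter mem_rev mem_iota /= ltn_ord andbT.
    by rewrite (mem_image val_inj).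
  rewrite -evenE // => evl; have lE : l \in evens by rewrite mem_filter evl.
  have /andP[ul wl] := wsubs l lS.
  have [nz eqn] := frac_isP (phiC l lE).
  rewrite (sumE _ (fun t => sublist t l)) => [|K /wsubs/andP[_ wK]]; last first.
    apply/allP/subsetP => [Kl i|Kl j jK]; first by rewrite !inE => /Kl.
    by have [i ji iK] := wflP wK jK; have := Kl i iK; rewrite inE ji.
  rewrite -(phi_sumP thE th_ge mtE size_mt cartE orderP ul wl (wevens _) nz) eqn.
  case: (l) wl => [|j l'] /=; last first.
    case/andP=> jn _; case: eqP => // /setP/(_ (Ordinal jn)).
    by rewrite !inE eqxx.
  by rewrite (_ : lset [::] = set0) ?eqxx //; apply/setP => i; rewrite !inE.
move=> d; apply/eqP; rewrite -(eqr_int rat); apply/eqP; rewrite (coef_char_poly2 d phi_eq).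
(* The rank is at most 9, so half-ranks stay below 5 and the higher coefficients vanish. *)
have [d5|d5] := ltnP d 5; last first.
  rewrite nth_default ?(leq_trans szcs) // big1 // => K /andP[_ /eqP Kd].
  have : (#|K| <= n)%N by rewrite -[leqRHS]card_ord max_card.
  by move: Kd d5 n10; rewrite -divn2; clear; lia.
have dI : d \in iota 0 5 by rewrite mem_iota.
have [nz eqn] := frac_isP (coefC d dI).
rewrite (eq_bigl (fun K : {set 'I_n} => (#|K|./2 == d) && even_components m K)); last first.
  by move=> K; rewrite andbC.
rewrite (sumE _ (fun t => (size t)./2 == d)) => [|K /wsubs/andP[uK wK]]; last first.
  by rewrite card_lset.
rewrite -lset_full.
by rewrite -(phi_sumP thE th_ge mtE size_mt cartE orderP ufull wfl_full (wevens _) nz) eqn.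
Qed.

End Check.
End Coxeter.

(** * The exceptional types *)

Section CosValues.
Variable R : realType.

Lemma cos_mulr3n (x : R) : cos (x *+ 3) = 4 * cos x ^+ 3 - 3 * cos x.
Proof.
rewrite mulrSr cosD cos_mulr2n sin_mulr2n.
have -> : cos x * sin x *+ 2 * sin x = cos x * sin x ^+ 2 *+ 2 by ring.
by rewrite sin2cos2; ring.
Qed.

Lemma cos_pi_gt0 (k : nat) : (2 < k)%N -> 0 < cos (pi / k%:R : R).
Proof.
move=> k2; apply: cos_gt0_pihalf; have pi0 := pi_gt0 R.
have k0 : 0 < k%:R :> R by rewrite ltr0n; lia.
rewrite (lt_trans (y := 0)) ?oppr_lt0 ?divr_gt0 //=.
by rewrite ltr_pM2l // ltf_pV2 ?posrE ?ltr_nat.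
Qed.

Lemma cos_pi3 : cos (pi / 3 : R) = 1 / 2.
Proof.
have := cos_mulr3n (pi / 3); have -> : pi / 3 *+ 3 = pi :> R by field.
rewrite cospi.
have := @cos_pi_gt0 3 isT; set c := cos _ => c0 cE.
have /eqP : (c + 1) * (2 * c - 1) ^+ 2 = 0.
  have -> : (c + 1) * (2 * c - 1) ^+ 2 = 4 * c ^+ 3 - 3 * c + 1 by ring.
  by rewrite -cE addNr.
rewrite mulf_eq0 gt_eqF ?addr_gt0 //= sqrf_eq0 subr_eq0 => /eqP c1.
by apply: (mulfI (x := 2)); rewrite ?pnatr_eq0 // c1; field.
Qed.

Lemma cos_pi4 : (2 * cos (pi / 4 : R)) ^+ 2 = 2.
Proof.
have := cos_mulr2n (pi / 4 : R); have -> : pi / 4 *+ 2 = pi / 2 :> R by field.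
by rewrite cos_pihalf => /esym/eqP; rewrite subr_eq0 exprMn => /eqP c2; lra.
Qed.

(** For x = pi/5 one has cos 3x = - cos 2x; cancelling the positive factor cos x + 1 leaves the
    quadratic equation of the golden ratio. *)
Lemma cos_pi5 : (2 * cos (pi / 5 : R)) ^+ 2 = 2 * cos (pi / 5 : R) + 1.
Proof.
have c3 := cos_mulr3n (pi / 5 : R); have c2 := cos_mulr2n (pi / 5 : R).
have pE : pi / 5 *+ 3 = pi - pi / 5 *+ 2 :> R by field.
move: c3; rewrite pE cosB cospi sinpi mul0r addr0 c2.
have := @cos_pi_gt0 5 isT; set c := cos _ => c0 cE.
have /eqP : (c + 1) * (4 * c ^+ 2 - 2 * c - 1) = 0.
  have -> : (c + 1) * (4 * c ^+ 2 - 2 * c - 1) =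
      4 * c ^+ 3 - 3 * c - (-1 * (c ^+ 2 *+ 2 - 1)) by ring.
  by rewrite -cE subrr.
by rewrite mulf_eq0 gt_eqF ?addr_gt0 //= => /eqP h; lra.
Qed.

End CosValues.

(** * Coxeter matrices, tables and the final verification *)

Lemma cox_entryC edges i j : cox_entry edges i j = cox_entry edges j i.
Proof.
rewrite /cox_entry eq_sym; case: eqP => // _; congr (head _ (map _ _)).
by apply: eq_filter => x; rewrite orbC.
Qed.

Lemma cox_entry_in edges i j : i != j ->
  cox_entry edges i j \in 2%N :: [seq x.2 | x <- edges].
Proof.
rewrite /cox_entry => /negPf->; elim: edges => //= x edges IH; case: ifP => _ /=.
  by rewrite !inE eqxx orbT.
by move: IH; rewrite !inE => /orP[->|->]; rewrite ?orbT.
Qed.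

(* Every edge of the Coxeter graph has label 3 or [last_label X].                  *)
Definition last_label (X : exceptional_type) : nat :=
  match X with H3 | H4 => 5 | _ => 4 end.

Lemma cox_entry_label X i j :
  cox_entry (cox_edges X) i j \in [:: 1; 2; 3; last_label X]%N.
Proof.
case: (eqVneq i j) => [->|/(cox_entry_in (cox_edges X))].
  by rewrite /cox_entry eqxx.
by apply: (allP (a := [in [:: 1; 2; 3; last_label X]%N])); case: X.
Qed.

Definition cox_table (X : exceptional_type) : seq (seq nat) :=
  [seq [seq cox_entry (cox_edges X) i j | j <- iota 0 (cox_size X)]
     | i <- iota 0 (cox_size X)].

(* 2 cos (pi / last_label X) is a root of x^2 - p x - q.                           *)
Definition theta_coefs (X : exceptional_type) : Z * Z :=
  match X with H3 | H4 => (1, 1)%BZ | _ => (0, 2)%BZ end.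

Lemma cosE (R : realType) X (k : nat) (th := 2 * cos (pi / (last_label X)%:R : R)) :
  k \in [:: 1; 2; 3; last_label X]%N -> qval th (qcartan k) = - (2 * cos (pi / k%:R)).
Proof.
rewrite {}/th; have z0 : zval R 0%BZ = 0 by [].
have z1 : zval R (-1)%BZ = -1 by [].
rewrite !inE => /or4P[]/eqP->.
- by rewrite /qval /= z0 divr1 cospi (_ : zval R 2%BZ = 2) // mul0r addr0; ring.
- by rewrite /qval /= z0 mul0r addr0 cos_pihalf mulr0 oppr0.
- by rewrite /qval /= z0 z1 mul0r addr0 cos_pi3; field.
by case: X; rewrite /qval /= z0 z1 add0r mulN1r.
Qed.

Lemma thetaE (R : realType) X (th := 2 * cos (pi / (last_label X)%:R : R)) :
  th ^+ 2 = zval R (theta_coefs X).1 * th + zval R (theta_coefs X).2 /\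
  0 <= 2 * th - zval R (theta_coefs X).1.
Proof.
have [z0 z1 z2] : [/\ zval R 0%BZ = 0, zval R 1%BZ = 1 & zval R 2%BZ = 2] by [].
have th0 : 0 < th by rewrite mulr_gt0 // cos_pi_gt0 //; case: (X).
rewrite {}/th in th0 *; case: X th0 => /= th0; rewrite ?z0 ?z1 ?z2 ?mul0r ?add0r ?mul1r;
  split; rewrite ?cos_pi4 ?cos_pi5 ?subr0 //; try by rewrite mulr_ge0 // ltW.
- have := cos_pi5 R; set c := 2 * _ in th0 *; nra.
- have := cos_pi5 R; set c := 2 * _ in th0 *; nra.
Qed.

(* For the even K in a given type, the rank and the order of W_K determine the     *)
(* Moebius number mu(1, W_K), which is the third component.                        *)
Definition mobius_table (X : exceptional_type) : seq (nat * Z * Z) :=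
  [:: (0%N, 1, 1); (2%N, 6, -1); (2%N, 8, -1); (2%N, 10, -1)]%BZ ++
  match X with
  | H3 => [::]
  | F4 => [:: (4%N, 1152, 49)]
  | H4 => [:: (4%N, 14400, 271)]
  | E6 | E7 | E8 =>
    [:: (4%N, 36, 1); (4%N, 120, 9); (4%N, 192, 15); (6%N, 720, -9);
      (6%N, 1152, -15); (6%N, 5040, -225); (6%N, 23040, -1170);
      (6%N, 51840, -2620); (8%N, 696729600, 17735221)]
  end%BZ.

Definition char_coefs (X : exceptional_type) : seq Z :=
  match X with
  | H3 => [:: 1; -16]
  | F4 => [:: 1; -50; 49]
  | H4 => [:: 1; -272; 271]
  | E6 => [:: 1; -120; 2739; -2620]
  | E7 => [:: 1; -336; 26229; -230014]
  | E8 => [:: 1; -1120; 332178; -18066280; 17735221]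
  end%BZ.

Lemma exceptional_check X :
  coxeter_check (theta_coefs X).1 (theta_coefs X).2 (cox_size X) (cox_table X)
    (mobius_table X) (char_coefs X).
Proof. by case: X; vm_compute. Qed.

Lemma int_of_Z_of_N (N : BinNums.N) : int_of_Z (Z.of_N N) = Posz (nat_of_bin N).
Proof. lia. Qed.

(* The numerals are natural numbers in unary notation as soon as [nat_of_bin] is  *)
(* reduced, so they are replaced by variables.                                    *)
Lemma char_coefs_poly (f : {rmorphism Z -> int}) X d :
    (forall N : BinNums.N, f (Z.of_N N) = Posz (nat_of_bin N)) ->
  (match X with
    | H3 => 1 - 16%num%:R *: 'X
    | F4 => 1 - 50%num%:R *: 'X + 49%num%:R *: 'X^2
    | H4 => 1 - 272%num%:R *: 'X + 271%num%:R *: 'X^2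
    | E6 => 1 - 120%num%:R *: 'X + 2739%num%:R *: 'X^2 - 2620%num%:R *: 'X^3
    | E7 => 1 - 336%num%:R *: 'X + 26229%num%:R *: 'X^2 - 230014%num%:R *: 'X^3
    | E8 => 1 - 1120%num%:R *: 'X + 332178%num%:R *: 'X^2 - 18066280%num%:R *: 'X^3
            + 17735221%num%:R *: 'X^4
    end : {poly int})`_d = f (nth Z0 (char_coefs X) d).
Proof.
move=> fN; case: X; repeat match goal with |- context [nat_of_bin ?c] =>
    generalize (fN c); generalize (nat_of_bin c) end; intros;
  rewrite ?(coefD, coefN, coefZ, coefXn, coefX, coef1) ?natz;
  case: d => [|[|[|[|[|d]]]]];
  rewrite /= ?nth_nil ?mulr0 ?mulr1 ?oppr0 ?addr0 ?add0r ?oppr0 ?addr0 ?add0r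
             ?rmorph0 ?rmorph1 //;
  by rewrite -[RHS]opprK -rmorphN; congr (- _).
Qed.

Theorem mainTheorem7 (R : realType) (X : exceptional_type)
    (gT : finGroupType) (W : {group gT}) (s : 'I_(cox_size X) -> gT)
    (rW : mx_representation R W (cox_size X))
    (sysW : coxeter_system (cox_matrix X) W s)
    (reflW : reflection_representation (cox_matrix X) s rW) :
  char_poly2 (cox_matrix X) s rW =
    match X with
    | H3 => 1 - 16%num%:R *: 'X
    | F4 => 1 - 50%num%:R *: 'X + 49%num%:R *: 'X^2
    | H4 => 1 - 272%num%:R *: 'X + 271%num%:R *: 'X^2
    | E6 => 1 - 120%num%:R *: 'X + 2739%num%:R *: 'X^2 - 2620%num%:R *: 'X^3
    | E7 => 1 - 336%num%:R *: 'X + 26229%num%:R *: 'X^2 - 230014%num%:R *: 'X^3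
    | E8 => 1 - 1120%num%:R *: 'X + 332178%num%:R *: 'X^2 - 18066280%num%:R *: 'X^3
            + 17735221%num%:R *: 'X^4
    end.
Proof.
have [genW relW _] := sysW; have [thE th_ge] := thetaE R X.
have tableE (i j : 'I_(cox_size X)) : mentry (cox_table X) i j = cox_matrix X i j.
  by rewrite /mentry /cox_table !(nth_map 0%N) ?size_iota ?nth_iota.
have sizeE (i : 'I_(cox_size X)) : size (nth [::] (cox_table X) i) = cox_size X.
  by rewrite (nth_map 0%N) ?size_map ?size_iota.
have diag (i : 'I_(cox_size X)) : cox_matrix X i i = 1%N.
  by rewrite /cox_matrix /cox_entry eqxx.
have off (i j : 'I_(cox_size X)) : i != j -> (1 < cox_matrix X i j)%N.
  move=> /(cox_entry_in (cox_edges X)).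
  by apply: (allP (a := fun k => 1 < k)%N); case: (X).
have sym (i j : 'I_(cox_size X)) : cox_matrix X i j = cox_matrix X j i.
  exact: cox_entryC.
have cartE (i j : 'I_(cox_size X)) := @cosE R X _ (cox_entry_label X i j).
apply/polyP => d; rewrite (@char_coefs_poly int_of_Z).
  apply: (coxeter_checkP diag off sym genW relW reflW thE th_ge tableE sizeE cartE _ _
           (exceptional_check X)); by case: (X).
exact: int_of_Z_of_N.
Qed.
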